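(* Let $f\in B(\mathbb{R},\mathbb{C})$. Then $f$ is in $AP(\mathbb{R},\mathbb{C})$ if and only if the closure of its set of translates $\{f(t+\tau):\tau\in\mathbb{R}\}$, in the topology of uniform convergence on $\mathbb{R}$, is compact and coincides with the equivalence class of $f$ with respect to $\overset{*}{\sim}$.
   Context: $AP(\mathbb{R},\mathbb{C})$ is the space of (Bohr, i.e. uniformly) almost periodic functions: continuous $f:\mathbb{R}\to\mathbb{C}$ such that for every $\varepsilon>0$ there is $l>0$ such that every interval of length $l$ contains a $\tau$ with $|f(t+\tau)-f(t)|\le\varepsilon$ for all $t\in\mathbb{R}$. $B(\mathbb{R},\mathbb{C})$ is the Besicovitch space, obtained by completing the trigonometric polynomials $\sum_{j=1}^n a_je^{i\lambda_jt}$ ($a_j\in\mathbb{C}$, $\lambda_j\in\mathbb{R}$) with respect to the seminorm $\limsup_{l\to\infty}\frac{1}{2l}\int_{-l}^{l}|f(t)|\,dt$. An element of $B(\mathbb{R},\mathbb{C})$ stands for a whole class of functions modulo the relation $f\simeq g$ iff $\limsup_{l\to\infty}\frac1{2l}\int_{-l}^{l}|f(t)-g(t)|\,dt=0$; $f$ is in $AP(\mathbb{R},\mathbb{C})$ means that the class contains a function of $AP(\mathbb{R},\mathbb{C})$ (necessarily unique), with which it is identified. $B(\mathbb{R},\mathbb{C})$ is endowed with the topology of uniform convergence on $\mathbb{R}$: the distance between two elements is the infimum of $\sup_{t\in\mathbb{R}}|f(t)-g(t)|$ over representatives $f,g$ (possibly $+\infty$). Each $f\in B(\mathbb{R},\mathbb{C})$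 has a Fourier series $\sum_{j\ge1}a_je^{i\lambda_jt}$, with coefficients $\lim_{l\to\infty}\frac{1}{2l}\int_{-l}^{l}f(t)e^{-i\lambda t}\,dt$, nonzero for at most countably many $\lambda\in\mathbb{R}$. Equivalence: let $\Lambda=\{\lambda_1,\lambda_2,\ldots\}$ be a countable set of distinct real numbers. Two elements of $B(\mathbb{R},\mathbb{C})$ with Fourier series $\sum_{j\ge1}a_je^{i\lambda_jt}$ and $\sum_{j\ge1}b_je^{i\lambda_jt}$ ($\lambda_j\in\Lambda$) are equivalent (written $\overset{*}{\sim}$) if for each integer $n$ with $1\le n\le\sharp\Lambda$ there exists a $\mathbb{Q}$-linear map $\psi_n:V_n\to\mathbb{R}$, where $V_n\subset\mathbb{R}$ is the $\mathbb{Q}$-vector space generated by $\{\lambda_1,\ldots,\lambda_n\}$, such that $b_j=a_je^{i\psi_n(\lambda_j)}$ for $j=1,\ldots,n$. The equivalence class of $f$ is the set of all elements equivalent to $f$, where $\Lambda$ is a set containing the exponents of the Fourier series of $f$. *)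

(* Defs.v *)
From HB Require Import structures.
From mathcomp Require Import all_boot all_order all_algebra.
From mathcomp Require Import all_classical all_reals all_analysis.
From mathcomp Require Import measurable_realfun complex.

Set Implicit Arguments.
Unset Strict Implicit.
Unset Printing Implicit Defensive.

Import Order.TTheory GRing.Theory Num.Theory numFieldNormedType.Exports.
Import ComplexField.Normc.

Local Open Scope classical_set_scope.
Local Open Scope ring_scope.
Local Open Scope complex_scope.
Local Open Scope quotient_scope.

Section BohrFunctions.
Context {R : realType}.

(* R[i]^o is R[i] with the topology of its norm. *)
Definition bohr_ap (f : R -> R[i]) : Prop :=
  continuous (f : R -> R[i]^o) /\
  forall e : R, 0 < e -> exists2 l : R, 0 < l &
    forall a : R, exists2 tau : R, `[a, a + l]%classic tau &
      forall t : R, normc (f (t + tau) - f t) <= e.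

Definition expi (x : R) : R[i] := cos x +i* sin x.

(* The pair (a, lambda) stands for the monomial a e^(i lambda t). *)
Definition trigpoly (s : seq (R[i] * R)) (t : R) : R[i] :=
  \sum_(p <- s) p.1 * expi (p.2 * t).

Definition locally_integrableC (f : R -> R[i]) : Prop :=
  locally_integrable setT (fun t => complex.Re (f t)) /\
  locally_integrable setT (fun t => complex.Im (f t)).

Definition bes_seminorm (f : R -> R[i]) : \bar R :=
  limf_esup (fun l : R => ((2 * l)^-1)%:E *
    \int[lebesgue_measure]_(t in `[(- l)%R, l]) (normc (f t))%:E)%E +oo.

(* By the completeness theorem of Marcinkiewicz, these functions modulo
   null functions realize the abstract completion of the space of
   trigonometric polynomials. *)
Definition besicovitch_fun : set (R -> R[i]) :=
  [set f | locally_integrableC f /\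
    forall e : R, 0 < e ->
      exists s, (bes_seminorm (f \- trigpoly s)%R < e%:E)%E].

Definition bes_eqv (f g : besicovitch_fun) : bool :=
  `[< bes_seminorm (val f \- val g) = 0%E >].

End BohrFunctions.
Arguments besicovitch_fun : clear implicits.

Section Preliminaries.
Context {R : realType}.
Implicit Types (f g h : R -> R[i]) (s : seq (R[i] * R)).

Lemma normc_ge0 (z : R[i]) : 0 <= normc z.
Proof. by case: z => a b; rewrite sqrtr_ge0. Qed.

Definition measurableC f :=
  measurable_fun setT (fun t => complex.Re (f t)) /\
  measurable_fun setT (fun t => complex.Im (f t)).

Lemma measurable_normc f : measurableC f ->
  measurable_fun setT (fun t => normc (f t)).
Proof.
move=> [mr mi].
have -> : (fun t => normc (f t)) =
    Num.sqrt \o (fun t => complex.Re (f t) ^+ 2 + complex.Im (f t) ^+ 2).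
  by apply/funext => t /=; case: (f t).
apply: measurableT_comp.
  apply: continuous_measurable_fun; exact: sqrt_continuous.
by apply: measurable_funD; apply: measurable_funX.
Qed.

Lemma locally_integrableC_measurable f :
  locally_integrableC f -> measurableC f.
Proof. by move=> [[mr _ _] [mi _ _]]. Qed.

Lemma measurableCD f g :
  measurableC f -> measurableC g -> measurableC (f \+ g).
Proof.
move=> [fr fi] [gr gi]; split.
  under eq_fun do rewrite raddfD.
  exact: measurable_funD.
under eq_fun do rewrite raddfD.
exact: measurable_funD.
Qed.

Lemma measurableCN f : measurableC f -> measurableC (\- f).
Proof.
move=> [fr fi]; split.
  under eq_fun do rewrite raddfN.
  exact: measurableT_comp.
under eq_fun do rewrite raddfN.
exact: measurableT_comp.
Qed.

Lemma measurableCB f g :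
  measurableC f -> measurableC g -> measurableC (f \- g).
Proof. by move=> mf mg; apply: measurableCD => //; exact: measurableCN. Qed.

Lemma measurableC_monomial (a : R[i]) (l : R) :
  measurableC (fun t => a * expi (l * t)).
Proof.
have mc : measurable_fun setT (fun t : R => cos (l * t)).
  apply: continuous_measurable_fun => t.
  apply: (@continuous_comp _ _ _ (fun t => l * t) cos).
    by apply: continuousM; [exact: cst_continuous|exact: id].
  exact: continuous_cos.
have ms : measurable_fun setT (fun t : R => sin (l * t)).
  apply: continuous_measurable_fun => t.
  apply: (@continuous_comp _ _ _ (fun t => l * t) sin).
    by apply: continuousM; [exact: cst_continuous|exact: id].
  exact: continuous_sin.
case: a => x y; split => /=.
  by apply: measurable_funB; apply: measurable_funM.
by apply: measurable_funD; apply: measurable_funM.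
Qed.

Lemma measurableC_trigpoly s : measurableC (trigpoly s).
Proof.
elim: s => [|p s ih].
  have -> : trigpoly [::] = (fun _ : R => 0 : R[i]) by apply/funext => t; exact: big_nil.
  by split; exact: measurable_cst.
have -> : trigpoly (p :: s) =
    (fun t => p.1 * expi (p.2 * t)) \+ trigpoly s.
  by apply/funext => t; rewrite /trigpoly big_cons.
by apply: measurableCD => //; exact: measurableC_monomial.
Qed.

Lemma trigpoly_cat s1 s2 :
  trigpoly (s1 ++ s2) = trigpoly s1 \+ trigpoly s2.
Proof. by apply/funext => t; rewrite /trigpoly big_cat. Qed.

Lemma trigpolyN s :
  trigpoly [seq (- p.1, p.2) | p <- s] = \- trigpoly s.
Proof.
apply/funext => t; rewrite /trigpoly big_map/= -sumrN.
by apply: eq_bigr => p _; rewrite mulNr.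
Qed.

Lemma bes_seminorm_ge0 f : (0 <= bes_seminorm f)%E.
Proof.
rewrite /bes_seminorm limf_esupE; apply: le_ereal_inf_tmp => _ [A [M [Mr AM]] <-].
apply: (@le_trans _ _ (((2 * (`|M| + 1))^-1)%:E *
  \int[lebesgue_measure]_(t in `[(- (`|M| + 1))%R, (`|M| + 1)%R]) (normc (f t))%:E)%E).
  apply: mule_ge0; first by rewrite lee_fin invr_ge0 mulr_ge0// addr_ge0.
  by apply: integral_ge0 => t _; rewrite lee_fin normc_ge0.
apply: ereal_sup_ubound; exists (`|M| + 1) => //; apply: AM.
by rewrite (le_lt_trans (ler_norm _))// ltrDl.
Qed.

Lemma bes_seminormN f : bes_seminorm (\- f) = bes_seminorm f.
Proof.
rewrite /bes_seminorm; congr (limf_esup _ _); apply/funext => l.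
by congr (_ * _)%E; apply: eq_integral => t _; rewrite normcN.
Qed.

Lemma bes_seminormD_lt f g (a b : R) : measurableC f -> measurableC g ->
  (bes_seminorm f < a%:E)%E -> (bes_seminorm g < b%:E)%E ->
  (bes_seminorm (f \+ g)%R < (a + b)%:E)%E.
Proof.
move=> mf mg; rewrite /bes_seminorm !limf_esupE.
move=> /ereal_inf_lt[_ [V FV <-] Va] /ereal_inf_lt[_ [W FW <-] Wb].
have FP : (+oo%R : set_system R) [set l | 0 < l].
  by exists 0; split => //; rewrite num_real.
have FVW : (+oo%R : set_system R) (V `&` W `&` [set l | 0 < l]).
  by apply: filterI => //; apply: filterI.
set A := fun (h : R -> R[i]) (l : R) => (((2 * l)^-1)%:E *
    \int[lebesgue_measure]_(t in `[(- l)%R, l]) (normc (h t))%:E)%E.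
have mE h (D : set R) : measurableC h -> measurable_fun D (fun t => (normc (h t))%:E).
  move=> mh; apply: (@measurable_funS _ _ _ _ setT) => //.
  by apply/measurable_EFinP; exact: measurable_normc.
apply: (@le_lt_trans _ _ (ereal_sup (A f @` V) + ereal_sup (A g @` W))%E);
    last by rewrite EFinD; exact: lteD.
apply: (@le_trans _ _ (ereal_sup (A (f \+ g) @` (V `&` W `&` [set l | 0 < l])))).
  by apply: ereal_inf_lbound; exists (V `&` W `&` [set l | 0 < l]).
apply: ge_ereal_sup => _ [l [[Vl Wl] l0] <-].
apply: (@le_trans _ _ (A f l + A g l)%E); last first.
  by apply: leeD; apply: ereal_sup_ubound; exists l.
rewrite /A -ge0_muleDr; [|by apply: integral_ge0 => t _; rewrite lee_fin normc_ge0..].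
apply: lee_wpmul2l; first by rewrite lee_fin invr_ge0 mulr_ge0// ltW.
rewrite -ge0_integralD//=; [|by move=> t _; rewrite lee_fin normc_ge0|exact: mE
  |by move=> t _; rewrite lee_fin normc_ge0|exact: mE].
apply: ge0_le_integral => //=.
- by move=> t _; rewrite lee_fin normc_ge0.
- by apply: mE; exact: measurableCD.
- by apply: emeasurable_funD; exact: mE.
- by move=> t _; rewrite -EFinD lee_fin le_normcD.
Qed.

Lemma bes_seminormD_eq0 f g : measurableC f -> measurableC g ->
  bes_seminorm f = 0%E -> bes_seminorm g = 0%E ->
  bes_seminorm (f \+ g) = 0%E.
Proof.
move=> mf mg f0 g0; apply/eqP; rewrite eq_le bes_seminorm_ge0 andbT.
apply/lee_addgt0Pr => e e0; rewrite add0e ltW//.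
by rewrite (splitr e) bes_seminormD_lt// ?f0 ?g0 lte_fin divr_gt0.
Qed.

Lemma bes_seminorm0 : bes_seminorm (fun=> 0 : R[i]) = 0%E.
Proof.
apply/eqP; rewrite eq_le bes_seminorm_ge0 andbT /bes_seminorm limf_esupE.
apply: (@le_trans _ _ (ereal_sup ((fun l : R => (((2 * l)^-1)%:E *
  \int[lebesgue_measure]_(t in `[(- l)%R, l]) (normc (0 : R[i]))%:E)%E) @` setT))).
  by apply: ereal_inf_lbound; exists setT => //; exact: filterT.
apply: ge_ereal_sup => _ [l _ <-].
by rewrite normc0 integral0 mule0.
Qed.

Lemma besicovitch_funM f : besicovitch_fun R f -> measurableC f.
Proof. by move=> [/locally_integrableC_measurable]. Qed.

Lemma besicovitch_funD f g :
  besicovitch_fun R f -> besicovitch_fun R g -> besicovitch_fun R (f \+ g).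
Proof.
move=> Bf Bg; have mf := besicovitch_funM Bf; have mg := besicovitch_funM Bg.
case: Bf Bg => [[fr fi] fP] [[gr gi] gP]; split.
  split; under eq_fun do rewrite raddfD; exact: locally_integrableD.
move=> e e0; have e20 : 0 < e / 2 by rewrite divr_gt0.
have [s1 s1P] := fP _ e20; have [s2 s2P] := gP _ e20.
exists (s1 ++ s2); rewrite trigpoly_cat (splitr e).
have -> : (f \+ g) \- (trigpoly s1 \+ trigpoly s2) =
    (f \- trigpoly s1) \+ (g \- trigpoly s2).
  by apply/funext => t /=; rewrite addrACA opprD.
exact: (bes_seminormD_lt (measurableCB mf (measurableC_trigpoly s1))
                         (measurableCB mg (measurableC_trigpoly s2))).
Qed.

Lemma besicovitch_funN f :
  besicovitch_fun R f -> besicovitch_fun R (\- f).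
Proof.
move=> [[fr fi] fP]; split.
  split; under eq_fun do rewrite raddfN; exact: locally_integrableN.
move=> e /fP[s sP]; exists [seq (- p.1, p.2) | p <- s]; rewrite trigpolyN.
rewrite (_ : _ \- _ = \- (f \- trigpoly s)) ?bes_seminormN//.
by apply/funext => t /=; rewrite opprD.
Qed.

Lemma bes_eqv_equiv : equiv_class_of (@bes_eqv R).
Proof.
have m (f : besicovitch_fun R) : measurableC (val f).
  by apply: besicovitch_funM; exact: set_valP.
split=> [f|f g|g f h].
- apply/asboolP; rewrite (_ : _ \- _ = fun=> 0) ?bes_seminorm0//.
  by apply/funext => t /=; rewrite subrr.
- apply/asbool_equiv_eq.
  rewrite (_ : val f \- val g = \- (val g \- val f)) ?bes_seminormN//.
  by apply/funext => t /=; rewrite opprB.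
- move=> /asboolP fg /asboolP gh; apply/asboolP.
  rewrite (_ : _ \- _ = (val f \- val g) \+ (val g \- val h)).
    by apply: bes_seminormD_eq0 => //; exact: measurableCB.
  by apply/funext => t /=; rewrite subrKA.
Qed.

Canonical bes_eqv_rel := EquivRelPack bes_eqv_equiv.

End Preliminaries.

Definition besicovitch (R : realType) := {eq_quot @bes_eqv_rel R}.
HB.instance Definition _ (R : realType) := Choice.on (besicovitch R).
HB.instance Definition _ (R : realType) := EqQuotient.on (besicovitch R).

Section Topology.
Context {R : realType}.
Implicit Types x y z : besicovitch R.

Definition representatives x : set (R -> R[i]) :=
  [set val f | f in [set f : besicovitch_fun R | \pi_(besicovitch R) f = x]].

Definition bes_dist x y : \bar R :=
  ereal_inf [set ereal_sup [set (normc (f t - g t))%:E | t in setT]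
            | f in representatives x & g in representatives y].

Definition bes_ball x (e : R) : set (besicovitch R) :=
  [set y | (bes_dist x y < e%:E)%E].

Lemma representatives_repr x : representatives x (val (repr x)).
Proof. by exists (repr x) => //=; rewrite reprK. Qed.

Lemma representatives_eqv x f g :
  representatives x f -> besicovitch_fun R g ->
  bes_seminorm (f \- g) = 0%E -> representatives x g.
Proof.
move=> [f' /= <- <-] Bg fg; exists (SigSub (mem_set Bg)) => //=.
by apply/esym/eqmodP/asboolP.
Qed.

Lemma bes_ballP x y e : bes_ball x e y <->
  exists f g, [/\ representatives x f, representatives y g &
    (ereal_sup [set (normc (f t - g t))%:E | t in setT] < e%:E)%E].
Proof.
split=> [/ereal_inf_lt[_ [f xf [g yg <-]] fg]|[f [g [xf yg fg]]]].
  by exists f, g.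
by apply: le_lt_trans fg; apply: ereal_inf_lbound; exists f => //; exists g.
Qed.

Lemma bes_ball_center x (e : R) : 0 < e -> bes_ball x e x.
Proof.
move=> e0; apply/bes_ballP; exists (val (repr x)), (val (repr x)); split;
  [exact: representatives_repr..|].
apply: (@le_lt_trans _ _ 0%E); last by rewrite lte_fin.
by apply: ge_ereal_sup => _ [t _ <-]; rewrite subrr normc0.
Qed.

Lemma bes_ball_sym x y (e : R) : bes_ball x e y -> bes_ball y e x.
Proof.
move=> /bes_ballP[f [g [xf yg fg]]]; apply/bes_ballP; exists g, f; split => //.
rewrite (_ : [set _ | _ in _] = [set (normc (f t - g t))%:E | t in setT])//.
by apply: eq_imagel => t _; rewrite -normcN opprB.
Qed.

Lemma bes_ball_triangle x y z (e1 e2 : R) :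
  bes_ball x e1 y -> bes_ball y e2 z -> bes_ball x (e1 + e2) z.
Proof.
move=> /bes_ballP[f [g [xf yg fg]]] /bes_ballP[g' [h [yg' zh gh]]].
have Bv (u : besicovitch_fun R) : besicovitch_fun R (val u).
  exact: set_valP.
have [Bg Bg' Bh] : [/\ besicovitch_fun R g, besicovitch_fun R g' &
    besicovitch_fun R h].
  by case: yg yg' zh => [? _ <-] [? _ <-] [? _ <-]; split; exact: Bv.
have gg' : bes_seminorm (g \- g') = 0%E.
  case: yg yg' => [u /= uy <-] [v /= vy <-].
  by have /eqmodP/asboolP := etrans uy (esym vy).
apply/bes_ballP; exists f, (h \+ (g \- g')); split => //.
  apply: (representatives_eqv zh).
    exact: (besicovitch_funD Bh (besicovitch_funD Bg (besicovitch_funN Bg'))).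
  rewrite (_ : h \- _ = \- (g \- g')) ?bes_seminormN//.
  by apply/funext => t /=; rewrite opprD addrA subrr add0r.
apply: le_lt_trans (lteD fg gh).
apply: ge_ereal_sup => _ [t _ <-].
apply: (@le_trans _ _ ((normc (f t - g t))%:E + (normc (g' t - h t))%:E)%E).
  rewrite -EFinD lee_fin; set u := f t - _.
  have -> : u = (f t - g t) + (g' t - h t).
    by rewrite /u /= [h t + _]addrC opprD opprB -[RHS]addrA;
       congr (_ + _); rewrite addrA [- g t + _]addrC.
  exact: le_normcD.
by apply: leeD; apply: ereal_sup_ubound; exists t.
Qed.

Lemma bes_nbhsE :
  nbhs_ball_ bes_ball = nbhs_ (entourage_ bes_ball).
Proof.
rewrite predeq2E => x P; split.
  move=> [e e0 eP]; exists [set xy | bes_ball xy.1 e xy.2]; first by exists e.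
  by move=> y /xsectionP /eP.
move=> [A [e e0 eA] AP]; exists e => // y xy.
by apply: AP; apply/xsectionP; exact: (eA (x, y)).
Qed.

HB.instance Definition _ :=
  hasNbhs.Build (besicovitch R) (nbhs_ball_ bes_ball).
HB.instance Definition _ := Nbhs_isPseudoMetric.Build R (besicovitch R)
  bes_nbhsE bes_ball_center bes_ball_sym bes_ball_triangle erefl.

End Topology.

Section Equivalence.
Context {R : realType}.
Implicit Types x y : besicovitch R.

Definition in_AP x : Prop := exists2 f, representatives x f & bohr_ap f.

(* The class of the translate does not depend on the representative f. *)
Definition translates x : set (besicovitch R) :=
  [set y | exists tau : R, exists2 f, representatives x f &
                             representatives y (fun t => f (t + tau))].

Definition bohr_mean (f : R -> R[i]) : R[i] :=
  lim ((fun l : R => ((2 * l)^-1)%:C *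
    ((\int[lebesgue_measure]_(t in `[- l, l]) complex.Re (f t)) +i*
     (\int[lebesgue_measure]_(t in `[- l, l]) complex.Im (f t))) : R[i]^o)
    @ +oo%R).

(* The mean does not depend on the representative. *)
Definition fourier_coef x (l : R) : R[i] :=
  bohr_mean (fun t => val (repr x) t * expi (- (l * t))).

Definition exponents x : set R := [set l | fourier_coef x l != 0].

(* lam lists without repetition the countable (possibly finite) set Lam;
   indices start at 0, so that j is an index iff j < #Lam. *)
Definition enumeration (Lam : set R) (lam : nat -> R) : Prop :=
  set_bij [set j | (`I_j.+1 #<= Lam)%card] Lam lam.

Definition qspan (lam : nat -> R) (n : nat) : set R :=
  [set v | exists q : 'I_n -> rat, v = \sum_(j < n) ratr (q j) * lam j].

(* Only the values of psi on V matter. *)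
Definition qlinear_on (V : set R) (psi : R -> R) : Prop :=
  forall (q : rat) u v, V u -> V v ->
    psi (ratr q * u + v) = ratr q * psi u + psi v.

Definition ap_equiv (Lam : set R) (lam : nat -> R) x y : Prop :=
  [/\ exponents x `<=` Lam, exponents y `<=` Lam &
    forall n, (1 <= n)%N -> (`I_n #<= Lam)%card ->
      exists2 psi : R -> R, qlinear_on (qspan lam n) psi &
        forall j, (j < n)%N ->
          fourier_coef y (lam j) = fourier_coef x (lam j) * expi (psi (lam j))].

Definition ap_class (Lam : set R) (lam : nat -> R) x
  : set (besicovitch R) := [set y | ap_equiv Lam lam x y].

End Equivalence.

(* Main.v *)
Require Import Defs.
From mathcomp Require Import all_boot all_order all_algebra.
From mathcomp Require Import all_classical all_reals all_analysis.
From mathcomp Require Import measurable_realfun complex ring lra.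
Require Import Defs.

(** Write [e(l, t)] for [e^(i l t)]. Translating [x] by [a] multiplies its
    Fourier coefficient at [l] by [e(l, a)], and the coefficients determine the
    class ([fourier_uniqueness]). Both directions compare, through this
    dictionary, translates with the phases [e(l, a)] at finitely many [l].

    Concentration. For a finite set [J] of frequencies and phases
    [e^(- i psi l)] with [psi] additive, the product [bump] of the factors
    [(1 + cos (l t + psi l)) / 2] lies in [[0, 1]] and is close to [1] exactly
    when all the [e(l, t)] are close to the given phases. The mean of its
    [N]-th power does not depend on [psi] and decays only polynomially in [N]
    ([bump_power]), whereas [bump^N] is exponentially small away from these
    times. Hence such times occur in every long enough window ([kronecker]);
    and for [psi = 0] normalized powers are kernels [K >= 0] of mean [1]
    supported, up to a small error, on the common almost periods of [J]
    ([concentrated_kernel]).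

    Uniqueness. If all coefficients of [f] vanish, [f] has mean zero against
    every trigonometric polynomial. When [P] is a trigonometric polynomial
    close to [f], there is another one, of modulus at most [1], which
    multiplies [P] to nearly [|P|] ([sign_multiplier]); so the mean of [|P|]
    is small, and [f] is null.

    Compactness implies almost periodicity ([compact_in_AP]). On the compact
    closure of the translates the uniform distance is controlled by finitely
    many Fourier coefficients, so there are [J] and [d] such that the translate
    by [t] is close to [x] as soon as the phases [e(l, t)], [l] in [J], are
    [d]-close to [1] ([compact_common_almost_periods]). Averaging translates
    against a kernel concentrated on such [t] gives a trigonometric polynomial
    close to [x]. As elements are only defined modulo null functions,
    closeness is expressed by duality, against trigonometric polynomials [s]
    dominated by some [k] ([filter_approximation]); for two trigonometric
    polynomials it gives back the uniform distance ([trigpoly_sup_dual]). The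
    approximants are therefore uniformly Cauchy, their limit is almost
    periodic, and it has the coefficients of [x].

    Almost periodicity implies compactness ([in_AP_compact]). By uniform
    continuity and almost periodicity, translates of a Bohr function converge
    uniformly along any ultrafilter of translation parameters
    ([bohr_ultra_limit]). The closure is then the whole class. An element
    of the closure is the limit of translates along an ultrafilter; the
    characters [v |-> e(v, a)] converge along it, and on a finitely generated
    rational space the limit is [e^(i psi v)] for a rational linear [psi]
    ([lift_phase]). Conversely, the phases prescribed by an element of the class
    are approximated by translations, thanks to Kronecker's theorem; the
    translates have a uniform limit, which has the prescribed coefficients. *)

Set Implicit Arguments.
Unset Strict Implicit.
Unset Printing Implicit Defensive.

Import Order.TTheory GRing.Theory Num.Theory numFieldNormedType.Exports.
Import ComplexField.Normc.

Local Open Scope classical_set_scope.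
Local Open Scope ring_scope.
Local Open Scope complex_scope.

(** * Complex numbers of the form [e^(i x)] *)

Section Complex.
Context {R : realType}.
Implicit Types (z w : R[i]) (x y : R).

Lemma cReD z w : complex.Re (z + w) = complex.Re z + complex.Re w.
Proof. by case: z; case: w. Qed.

Lemma cImD z w : complex.Im (z + w) = complex.Im z + complex.Im w.
Proof. by case: z; case: w. Qed.

Lemma cReN z : complex.Re (- z) = - complex.Re z.
Proof. by case: z. Qed.

Lemma cImN z : complex.Im (- z) = - complex.Im z.
Proof. by case: z. Qed.

Lemma cReM z w : complex.Re (z * w) =
  complex.Re z * complex.Re w - complex.Im z * complex.Im w.
Proof. by case: z; case: w. Qed.

Lemma cImM z w : complex.Im (z * w) =
  complex.Re z * complex.Im w + complex.Im z * complex.Re w.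
Proof. by case: z => a b; case: w => c d /=; ring. Qed.

Lemma complexP z w :
  complex.Re z = complex.Re w -> complex.Im z = complex.Im w -> z = w.
Proof. by case: z; case: w => a b c d /= -> ->. Qed.

Lemma sqr_normc2 z : normc z ^+ 2 = complex.Re z ^+ 2 + complex.Im z ^+ 2.
Proof. by case: z => a b /=; rewrite sqr_sqrtr// addr_ge0 ?sqr_ge0. Qed.

Lemma normr_Re_le z : `|complex.Re z| <= normc z.
Proof.
rewrite -[leRHS]ger0_norm ?normc_ge0// -ler_sqr ?nnegrE// !real_normK ?num_real//.
by rewrite sqr_normc2 lerDl sqr_ge0.
Qed.

Lemma normr_Im_le z : `|complex.Im z| <= normc z.
Proof.
rewrite -[leRHS]ger0_norm ?normc_ge0// -ler_sqr ?nnegrE// !real_normK ?num_real//.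
by rewrite sqr_normc2 lerDr sqr_ge0.
Qed.

Lemma normc_real x : normc x%:C = `|x|.
Proof. by rewrite /= expr0n/= addr0 sqrtr_sqr. Qed.

Lemma normc_le_ReIm z : normc z <= `|complex.Re z| + `|complex.Im z|.
Proof.
rewrite -ler_sqr ?nnegrE ?normc_ge0 ?addr_ge0// sqr_normc2.
rewrite -(real_normK (num_real (complex.Re z))).
rewrite -(real_normK (num_real (complex.Im z))).
by rewrite sqrrD addrAC lerDl mulrn_wge0// mulr_ge0.
Qed.

Lemma normc_conj z : normc (conjc z) = normc z.
Proof. by case: z => a b /=; rewrite sqrrN. Qed.

Lemma cconjM z w : conjc (z * w) = conjc z * conjc w.
Proof. exact: rmorphM. Qed.

Lemma mul_conj z : z * conjc z = (normc z ^+ 2)%:C.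
Proof.
rewrite sqr_normc2; case: z => a b /=.
by apply: complexP; rewrite ?cReM ?cImM/=; ring.
Qed.

Lemma normcBC z w : normc (z - w) = normc (w - z).
Proof. by rewrite -normcN opprB. Qed.

Lemma normcD_le z w a b : normc z <= a -> normc w <= b -> normc (z + w) <= a + b.
Proof. by move=> za wb; apply: le_trans (le_normcD _ _) _; exact: lerD. Qed.

Lemma normcB_le z w a b : normc z <= a -> normc w <= b -> normc (z - w) <= a + b.
Proof. by move=> za wb; apply: normcD_le => //; rewrite normcN. Qed.

Lemma normc_dist_le w z v a b :
  normc (z - w) <= a -> normc (w - v) <= b -> normc (z - v) <= a + b.
Proof. by move=> za wb; rewrite -(subrKA w); exact: normcD_le. Qed.

Lemma normc_sum (I : Type) (r : seq I) (F : I -> R[i]) :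
  normc (\sum_(i <- r) F i) <= \sum_(i <- r) normc (F i).
Proof.
elim: r => [|i r ih]; first by rewrite !big_nil normc0.
by rewrite !big_cons; apply: le_trans (le_normcD _ _) _; rewrite lerD2l.
Qed.

Lemma normc_small0 z : (forall e : R, 0 < e -> normc z <= e) -> z = 0.
Proof.
move=> h; apply: eq0_normc; apply/eqP; rewrite eq_le normc_ge0 andbT.
by apply/ler_addgt0Pr => e e0; rewrite add0r h.
Qed.

Lemma expi0 : expi 0 = 1 :> R[i].
Proof. by rewrite /expi cos0 sin0. Qed.

Lemma expiD x y : expi (x + y) = expi x * expi y.
Proof.
by rewrite /expi cosD sinD; apply: complexP; rewrite ?cReM ?cImM/=; ring.
Qed.

Lemma expiN x : expi (- x) = conjc (expi x).
Proof. by rewrite /expi cosN sinN. Qed.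

Lemma normc_expi x : normc (expi x) = 1.
Proof. by rewrite /= cos2Dsin2 sqrtr1. Qed.

Lemma expiVN x : expi x * expi (- x) = 1.
Proof. by rewrite -expiD subrr expi0. Qed.

Lemma MVT_lip (f df : R -> R) x y : (forall t : R, is_derive t 1 f (df t)) ->
  (forall t, `|df t| <= 1) -> `|f x - f y| <= `|x - y|.
Proof.
move=> fdf df1; wlog yx : x y / y <= x.
  move=> wl; have [/wl//|/ltW/wl] := leP y x.
  by rewrite distrC [leRHS]distrC.
have [//|c _ ->] := @MVT_segment R f df y x yx (fun t _ => fdf t).
  by apply: derivable_within_continuous => t _; have [] := fdf t.
by rewrite normrM ler_piMl.
Qed.

Lemma expi_lip x y : normc (expi x - expi y) <= 2 * `|x - y|.
Proof.
apply: le_trans (normc_le_ReIm _) _; rewrite cReD cImD cReN cImN /= mulr2n mulrDl mul1r.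
apply: lerD.
  apply: (@MVT_lip _ (fun t => - sin t)) => t; rewrite normrN.
  by rewrite ler_norml sin_geN1 sin_le1.
apply: (@MVT_lip _ cos) => t; rewrite ler_norml cos_geN1 cos_le1//.
Qed.

End Complex.

(** * Completeness *)

Section Completeness.
Context {R : realType}.

Lemma invS_lt (e : R) : 0 < e -> exists n : nat, n.+1%:R^-1 < e.
Proof.
move=> e0; have [N _ /(_ N (leqnn _))] := near_infty_natSinv_lt (PosNum e0).
by exists N.
Qed.

Lemma cauchy_invS_cvg (u : nat -> R) :
  (forall k m, `|u k - u m| <= k.+1%:R^-1 + m.+1%:R^-1) ->
  exists l, forall e, 0 < e -> \forall m \near \oo, `|l - u m| < e.
Proof.
move=> hu; suff /cvg_ex[l ul] : cvgn u.
  by exists l => e e0; move/cvgrPdist_lt : ul; apply.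
apply/cauchy_cvgP/cauchy_exP => e e0.
have [n ne] := invS_lt (divr_gt0 e0 (ltr0n _ 2)).
exists (u n), n => // m /= nm; rewrite /ball/=.
apply: le_lt_trans (hu _ _) _; rewrite (splitr e); apply: ltrD => //.
by apply: le_lt_trans ne; rewrite lef_pV2 ?posrE// ler_nat.
Qed.

(** The rate [1 / (n + 1)] is part of the conclusion, so that [h k] may be
    replaced by the limit at a known cost. *)
Lemma uniform_cauchy_lim (T : Type) (h : nat -> T -> R[i]) :
  (forall k m t, normc (h k t - h m t) <= k.+1%:R^-1 + m.+1%:R^-1) ->
  exists g, forall k t, normc (g t - h k t) <= k.+1%:R^-1.
Proof.
move=> hc.
have hr t : exists z : R[i], forall k, normc (z - h k t) <= k.+1%:R^-1.
  have [x xP] : exists x, forall e, 0 < e ->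
      \forall m \near \oo, `|x - complex.Re (h m t)| < e.
    apply: cauchy_invS_cvg => k m.
    by apply: le_trans (hc k m t); rewrite -cReN -cReD normr_Re_le.
  have [y yP] : exists y, forall e, 0 < e ->
      \forall m \near \oo, `|y - complex.Im (h m t)| < e.
    apply: cauchy_invS_cvg => k m.
    by apply: le_trans (hc k m t); rewrite -cImN -cImD normr_Im_le.
  exists (x +i* y) => k; apply/ler_addgt0Pr => e e0.
  have e3 : 0 < e / 3 by rewrite divr_gt0.
  have [n0 n0e] := invS_lt e3.
  have [m [[xm ym] mn]] : exists m, (`|x - complex.Re (h m t)| < e / 3 /\
      `|y - complex.Im (h m t)| < e / 3) /\ (n0 <= m)%N.
    suff : \forall m \near \oo, (`|x - complex.Re (h m t)| < e / 3 /\
      `|y - complex.Im (h m t)| < e / 3) /\ (n0 <= m)%N by move/filter_ex.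
    by near=> m; split; [split|]; near: m; [exact: xP|exact: yP|exact: nbhs_infty_ge].
  have -> : k.+1%:R^-1 + e = (e / 3 + e / 3) + (e / 3 + k.+1%:R^-1) by field.
  apply: (@normc_dist_le _ (h m t)).
    apply: le_trans (normc_le_ReIm _) _.
    by rewrite cReD cImD cReN cImN/= lerD// ltW.
  apply: le_trans (hc _ _ _) _; rewrite lerD2r; apply: le_trans (ltW n0e).
  by rewrite lef_pV2 ?posrE// ler_nat ltnS.
exists (fun t => projT1 (cid (hr t))) => k t; exact: (projT2 (cid (hr t))).
Unshelve. all: by end_near. Qed.

End Completeness.

(** * Averages over symmetric intervals *)

Section LocallyIntegrable.
Context {R : realType}.
Notation mu := (@lebesgue_measure R).
Implicit Types (h k : R -> R) (f g : R -> R[i]).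

Notation LI := (locally_integrable setT).

Lemma sym_itv_compact (l : R) : compact `[- l, l].
Proof. exact: segment_compact. Qed.

Lemma locally_integrable_itv h l : LI h -> mu.-integrable `[- l, l] (EFin \o h).
Proof.
move=> [mh _ hfin]; apply/integrableP; split.
  by apply/measurable_EFinP; exact: measurable_funS mh.
by apply: hfin => //; exact: sym_itv_compact.
Qed.

Lemma locally_integrable_le h k : measurable_fun setT k -> LI h ->
  (forall t, `|k t| <= h t) -> LI k.
Proof.
move=> mk [mh oT hfin] kh; split=> // K KT cK.
apply: le_lt_trans (hfin K KT cK); have mK := compact_measurable cK.
apply: ge0_le_integral => //=.
- apply/measurable_EFinP; apply: measurableT_comp => //.
  exact: measurable_funS mk.
- apply/measurable_EFinP; apply: measurableT_comp => //.
  exact: measurable_funS mh.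
- by move=> t _; rewrite lee_fin (le_trans (kh t))// ler_norm.
Qed.

Lemma locally_integrable_cst (c : R) : LI (fun=> c).
Proof.
split=> [||K _ cK]; [exact: measurable_cst|exact: openT|].
rewrite integral_cst//; last exact: compact_measurable.
by rewrite lte_mul_pinfty// compact_finite_measure.
Qed.

Lemma locally_integrableZ h (c : R) : LI h -> LI (fun t => c * h t).
Proof.
move=> [mh oT hfin]; split=> // [|K KT cK].
  exact: measurable_funM.
under eq_integral do rewrite normrM EFinM.
rewrite ge0_integralZl//=; last 2 first.
- exact: compact_measurable.
- apply/measurable_EFinP; apply: measurableT_comp => //.
  exact: measurable_funS mh.
by rewrite lte_mul_pinfty// hfin.
Qed.

(** Both measures agree on half-open intervals, which determine them. *)
Lemma lebesgue_measure_translate (a : R) (A : set R) : measurable A ->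
  pushforward mu ((fun t => t + a) : _ -> measurableTypeR R) A = mu A.
Proof.
have ma : measurable_fun setT ((fun t => t + a) : R -> measurableTypeR R).
  by apply: measurable_funD.
move=> mA; apply/esym.
apply: lebesgue_measure_unique => //= _ [[x y]] _ <-.
rewrite /pushforward.
rewrite (_ : _ @^-1` _ = `]x - a, y - a]%classic); last first.
  by apply/seteqP; split=> t /=; rewrite !in_itv/= ltrBlDr lerBrDr.
rewrite !lebesgue_measure_itv/= !lte_fin ltrD2r.
by case: ifP => // _; rewrite -!EFinB; congr (_%:E); ring.
Qed.

Lemma ge0_integral_translate (a x y : R) (h : R -> R) : measurable_fun setT h ->
  (forall t, 0 <= h t) ->
  (\int[mu]_(t in `[x, y]) (h (t + a)%R)%:E =
   \int[mu]_(t in `[(x + a)%R, (y + a)%R]) (h t)%:E)%E.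
Proof.
move=> mh h0.
have ma : measurable_fun setT ((fun t => t + a) : R -> measurableTypeR R).
  by apply: measurable_funD.
pose phi : R -> measurableTypeR R := fun t => t + a.
rewrite (_ : `[x, y]%classic = phi @^-1` `[x + a, y + a]); last first.
  by apply/seteqP; split=> t /=; rewrite !in_itv/= !lerD2r.
rewrite -[LHS]/(\int[mu]_(t in phi @^-1` `[(x + a)%R, (y + a)%R])
  ((EFin \o h) \o phi) t)%E.
rewrite -ge0_integral_pushforward//=.
- apply: eq_measure_integral => //= A mA AS; exact/lebesgue_measure_translate.
- by apply/measurable_EFinP; exact: measurable_funS mh.
- by move=> t _; rewrite lee_fin.
Qed.

Lemma locally_integrable_translate h (a : R) : LI h -> LI (fun t => h (t + a)).
Proof.
move=> [mh oT hfin].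
have ma : measurable_fun setT (fun t : R => t + a) by apply: measurable_funD.
have mha : measurable_fun setT (fun t : R => h (t + a)) by exact: measurableT_comp.
split=> // K KT cK.
have [M [_ MK]] := compact_bounded cK.
pose N := `|M| + 1.
have KN : K `<=` `[- N, N]%classic.
  move=> t Kt /=; rewrite in_itv/= -ler_norml; apply: (MK N) => //.
  by rewrite /N (le_lt_trans (ler_norm _))// ltrDl.
apply: (@le_lt_trans _ _ (\int[mu]_(t in `[(- N)%R, N]) `|h (t + a)%R|%:E)%E).
  apply: ge0_subset_integral => //=; first exact: compact_measurable.
  apply/measurable_EFinP; apply: measurableT_comp => //.
  exact: measurable_funS mha.
rewrite (@ge0_integral_translate a _ _ (fun t => `|h t|))//.
  by apply: hfin => //; exact: segment_compact.
exact: measurableT_comp.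
Qed.

Lemma locally_integrable_normc f : locally_integrableC f ->
  LI (fun t => normc (f t)).
Proof.
move=> Lf; have [Lr Li] := Lf.
have LIabs h : LI h -> LI (fun t => `|h t|).
  move=> [mh oT hfin]; split => //; first exact: measurableT_comp.
  by move=> K KT cK; under eq_integral do rewrite normr_id; exact: hfin.
apply: (@locally_integrable_le (fun t => `|complex.Re (f t)| + `|complex.Im (f t)|)).
- exact: measurable_normc (locally_integrableC_measurable Lf).
- exact: (locally_integrableD (LIabs _ Lr) (LIabs _ Li)).
- by move=> t; rewrite ger0_norm ?normc_ge0// normc_le_ReIm.
Qed.

Lemma locally_integrableC_le f h : measurableC f -> LI h ->
  (forall t, normc (f t) <= h t) -> locally_integrableC f.
Proof.
move=> [mr mi] Lh fh; split.
  apply: locally_integrable_le Lh _ => // t.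
  exact: le_trans (normr_Re_le _) (fh t).
apply: locally_integrable_le Lh _ => // t.
exact: le_trans (normr_Im_le _) (fh t).
Qed.

Lemma locally_integrableCD f g :
  locally_integrableC f -> locally_integrableC g -> locally_integrableC (f \+ g).
Proof.
move=> [fr fi] [gr gi]; split.
  by under eq_fun do rewrite /= cReD; exact: locally_integrableD.
by under eq_fun do rewrite /= cImD; exact: locally_integrableD.
Qed.

Lemma locally_integrableCN f :
  locally_integrableC f -> locally_integrableC (\- f).
Proof.
move=> [fr fi]; split.
  by under eq_fun do rewrite /= cReN; exact: locally_integrableN.
by under eq_fun do rewrite /= cImN; exact: locally_integrableN.
Qed.

Lemma locally_integrableCB f g :
  locally_integrableC f -> locally_integrableC g -> locally_integrableC (f \- g).
Proof.
by move=> Lf Lg; apply: locally_integrableCD => //; exact: locally_integrableCN.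
Qed.

Lemma measurableCM f g :
  measurableC f -> measurableC g -> measurableC (f \* g).
Proof.
move=> [fr fi] [gr gi]; split.
  under eq_fun do rewrite /= cReM.
  by apply: measurable_funB; exact: measurable_funM.
under eq_fun do rewrite /= cImM.
by apply: measurable_funD; exact: measurable_funM.
Qed.

Lemma locally_integrableCM f g (c : R) :
  locally_integrableC f -> measurableC g -> (forall t, normc (g t) <= c) ->
  locally_integrableC (f \* g).
Proof.
move=> Lf mg gc.
apply: (@locally_integrableC_le _ (fun t => c * normc (f t))).
- by apply: measurableCM => //; exact: locally_integrableC_measurable.
- exact/locally_integrableZ/locally_integrable_normc.
- by move=> t; rewrite /= normcM mulrC ler_wpM2r// normc_ge0.
Qed.

Lemma locally_integrableC_translate f (a : R) :
  locally_integrableC f -> locally_integrableC (fun t => f (t + a)).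
Proof.
move=> [fr fi]; split.
  exact: (@locally_integrable_translate (fun t => complex.Re (f t))).
exact: (@locally_integrable_translate (fun t => complex.Im (f t))).
Qed.

Lemma trigpoly_bound (s : seq (R[i] * R)) t :
  normc (trigpoly s t) <= \sum_(p <- s) normc p.1.
Proof.
apply: le_trans (normc_sum _ _) _; apply: ler_sum => p _.
by rewrite normcM normc_expi mulr1.
Qed.

Lemma locally_integrableC_trigpoly (s : seq (R[i] * R)) :
  locally_integrableC (trigpoly s).
Proof.
apply: locally_integrableC_le (trigpoly_bound s).
  exact: measurableC_trigpoly.
exact: locally_integrable_cst.
Qed.

End LocallyIntegrable.

Section Averages.
Context {R : realType}.
Notation mu := (@lebesgue_measure R).
Notation LI := (locally_integrable setT).
Implicit Types (h k : R -> R) (f g : R -> R[i]) (l : R).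

Definition ravg l h : R := (2 * l)^-1 * \int[mu]_(t in `[- l, l]) h t.

Definition cavg l f : R[i] :=
  ravg l (fun t => complex.Re (f t)) +i* ravg l (fun t => complex.Im (f t)).

Lemma ravgD l h k : LI h -> LI k ->
  ravg l (fun t => h t + k t) = ravg l h + ravg l k.
Proof.
move=> Lh Lk; rewrite /ravg RintegralD//; [by rewrite mulrDr|
  exact: locally_integrable_itv..].
Qed.

Lemma ravgZ l (c : R) h : LI h -> ravg l (fun t => c * h t) = c * ravg l h.
Proof.
move=> Lh; rewrite /ravg RintegralZl//; first by rewrite mulrCA.
exact: locally_integrable_itv.
Qed.

Lemma ravgN l h : LI h -> ravg l (fun t => - h t) = - ravg l h.
Proof.
move=> Lh; rewrite -[RHS]mulN1r -ravgZ//.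
by congr (ravg l _); apply/funext => t; rewrite mulN1r.
Qed.

Lemma ravg_le l h k : 0 < l -> LI h -> LI k -> (forall t, h t <= k t) ->
  ravg l h <= ravg l k.
Proof.
move=> l0 Lh Lk hk; rewrite /ravg ler_wpM2l//; first by rewrite invr_ge0 mulr_ge0// ltW.
by apply: le_Rintegral => //; exact: locally_integrable_itv.
Qed.

Lemma ravg_cst l (c : R) : 0 < l -> ravg l (fun=> c) = c.
Proof.
move=> l0; rewrite /ravg Rintegral_cst//= lebesgue_measure_itv/= lte_fin.
rewrite ifT ?(lt_trans _ l0) ?oppr_lt0// -EFinB/=; field.
by rewrite gt_eqF.
Qed.

Lemma ravg_ge0 l h : 0 < l -> (forall t, 0 <= h t) -> 0 <= ravg l h.
Proof.
move=> l0 h0; rewrite /ravg mulr_ge0//; first by rewrite invr_ge0 mulr_ge0// ltW.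
exact: Rintegral_ge0.
Qed.

Lemma ravg_norm l h k : 0 < l -> LI h -> LI k -> (forall t, `|h t| <= k t) ->
  `|ravg l h| <= ravg l k.
Proof.
move=> l0 Lh Lk hk; rewrite ler_norml -ravgN//; apply/andP; split.
  apply: ravg_le => // [|t]; first exact: locally_integrableN.
  by rewrite lerNl; have := hk t; rewrite -normrN; exact/le_trans/ler_norm.
by apply: ravg_le => // t; exact: le_trans (ler_norm _) (hk t).
Qed.

Lemma cavgD l f g : locally_integrableC f -> locally_integrableC g ->
  cavg l (f \+ g) = cavg l f + cavg l g.
Proof.
move=> [fr fi] [gr gi]; apply: complexP; rewrite ?cReD ?cImD /cavg /=.
  by under [X in ravg _ X]eq_fun do rewrite cReD; exact: ravgD.
by under [X in ravg _ X]eq_fun do rewrite cImD; exact: ravgD.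
Qed.

Lemma cavgZ l (c : R[i]) f : locally_integrableC f ->
  cavg l (fun t => c * f t) = c * cavg l f.
Proof.
move=> [fr fi]; apply: complexP; rewrite ?cReM ?cImM /cavg /=.
  under [X in ravg _ X]eq_fun do rewrite cReM -mulNr.
  by rewrite ravgD ?ravgZ ?mulNr//; exact: locally_integrableZ.
under [X in ravg _ X]eq_fun do rewrite cImM.
by rewrite ravgD ?ravgZ//; exact: locally_integrableZ.
Qed.

Lemma cavgN l f : locally_integrableC f -> cavg l (\- f) = - cavg l f.
Proof.
move=> Lf; rewrite -[RHS]mulN1r -cavgZ//.
by congr (cavg l _); apply/funext => t; rewrite mulN1r.
Qed.

Lemma cavgB l f g : locally_integrableC f -> locally_integrableC g ->
  cavg l (f \- g) = cavg l f - cavg l g.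
Proof.
by move=> Lf Lg; rewrite cavgD ?cavgN//; exact: locally_integrableCN.
Qed.

(** Bounding the two components separately costs a factor [2], which is
    harmless in all that follows. *)
Lemma cavg_norm l f k : 0 < l -> locally_integrableC f -> LI k ->
  (forall t, normc (f t) <= k t) -> normc (cavg l f) <= 2 * ravg l k.
Proof.
move=> l0 [fr fi] Lk fk; apply: le_trans (normc_le_ReIm _) _.
rewrite /cavg/= mulr2n mulrDl mul1r; apply: lerD; apply: ravg_norm => // t;
  apply: le_trans (fk t); [exact: normr_Re_le|exact: normr_Im_le].
Qed.

(** The translated window is contained in the symmetric one of half-length
    [l + |a|]; the factor tends to [1] as [l] grows. *)
Lemma ravg_translate l h (a : R) : 0 < l -> LI h -> (forall t, 0 <= h t) ->
  ravg l (fun t => h (t + a)) <= (l + `|a|) / l * ravg (l + `|a|) h.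
Proof.
move=> l0 Lh h0; have la : 0 < l + `|a| by rewrite ltr_pwDl.
have -> : (l + `|a|) / l * ravg (l + `|a|) h =
    (2 * l)^-1 * \int[mu]_(t in `[- (l + `|a|), l + `|a|]) h t.
  by rewrite /ravg; field; rewrite !gt_eqF.
rewrite /ravg ler_wpM2l//; first by rewrite invr_ge0 mulr_ge0// ltW.
have [mh _ _] := Lh.
rewrite /Rintegral ge0_integral_translate//.
have fin : (\int[mu]_(t in `[(- (l + `|a|))%R, (l + `|a|)%R]) (h t)%:E < +oo)%E.
  have /integrableP[_] := locally_integrable_itv (l + `|a|) Lh.
  by under eq_integral do rewrite /= ger0_norm//.
have sub : (\int[mu]_(t in `[(- l + a)%R, (l + a)%R]) (h t)%:E <=
    \int[mu]_(t in `[(- (l + `|a|))%R, (l + `|a|)%R]) (h t)%:E)%E.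
  apply: ge0_subset_integral => //=.
  - by apply/measurable_EFinP; exact: measurable_funS mh.
  - by move=> t _; rewrite lee_fin.
  - move=> t /=; rewrite !in_itv/= => /andP[la1 la2]; apply/andP; split.
      apply: le_trans la1; rewrite opprD lerD2l lerNl -normrN ler_norm//.
    by apply: le_trans la2 _; rewrite lerD2l ler_norm.
apply: fine_le => //.
  rewrite ge0_fin_numE; first exact: le_lt_trans sub fin.
  by apply: integral_ge0 => t _; rewrite lee_fin.
rewrite ge0_fin_numE//; by apply: integral_ge0 => t _; rewrite lee_fin.
Qed.

End Averages.

(** * Trigonometric polynomials *)

Section TrigPoly.
Context {R : realType}.
Implicit Types (s q : seq (R[i] * R)) (a z : R[i]) (l t : R).

Definition trigmean s : R[i] := \sum_(p <- s | p.2 == 0) p.1.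

Definition trigscale a s := [seq (a * p.1, p.2) | p <- s].

Definition trigmul s q := [seq (p.1 * r.1, p.2 + r.2) | p <- s, r <- q].

Definition trigconj s := [seq (conjc p.1, - p.2) | p <- s].

Definition trigshift t s := [seq (p.1 * expi (p.2 * t), p.2) | p <- s].

Lemma trigpoly_nil t : trigpoly [::] t = 0 :> R[i].
Proof. by rewrite /trigpoly big_nil. Qed.

Lemma trigpoly_cons p s t :
  trigpoly (p :: s) t = p.1 * expi (p.2 * t) + trigpoly s t.
Proof. by rewrite /trigpoly big_cons. Qed.

Lemma trigpoly1 a l t : trigpoly [:: (a, l)] t = a * expi (l * t).
Proof. by rewrite trigpoly_cons trigpoly_nil addr0. Qed.

Lemma trigpoly_cst a t : trigpoly [:: (a, 0)] t = a.
Proof. by rewrite trigpoly1 mul0r expi0 mulr1. Qed.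

Lemma trigpoly_catE s q t : trigpoly (s ++ q) t = trigpoly s t + trigpoly q t.
Proof. by rewrite trigpoly_cat. Qed.

Lemma trigpoly_scale a s t : trigpoly (trigscale a s) t = a * trigpoly s t.
Proof.
rewrite /trigpoly /trigscale big_map mulr_sumr.
by apply: eq_bigr => p _; rewrite mulrA.
Qed.

Lemma trigpoly_mul s q t : trigpoly (trigmul s q) t = trigpoly s t * trigpoly q t.
Proof.
rewrite /trigpoly /trigmul big_allpairs_dep mulr_suml.
apply: eq_bigr => p _; rewrite mulr_sumr; apply: eq_bigr => r _ /=.
by rewrite mulrDl expiD mulrACA.
Qed.

Lemma trigpoly_conj s t : trigpoly (trigconj s) t = conjc (trigpoly s t).
Proof.
rewrite /trigpoly /trigconj big_map rmorph_sum; apply: eq_bigr => p _.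
by rewrite /= mulNr expiN; symmetry; exact: rmorphM.
Qed.

Lemma trigpoly_shift s t u : trigpoly (trigshift t s) u = trigpoly s (u + t).
Proof.
rewrite /trigpoly /trigshift big_map; apply: eq_bigr => p _ /=.
by rewrite -mulrA -expiD -mulrDr addrC.
Qed.

Lemma trigpoly_lip s : exists2 C, 0 <= C &
  forall t u, normc (trigpoly s t - trigpoly s u) <= C * `|t - u|.
Proof.
elim: s => [|[a l] s [C C0 HC]].
  by exists 0 => // t u; rewrite !trigpoly_nil subrr normc0 mul0r.
exists (normc a * (2 * `|l|) + C) => [|t u].
  by rewrite addr_ge0// mulr_ge0 ?normc_ge0// mulr_ge0.
rewrite !trigpoly_cons opprD addrACA -mulrBr mulrDl; apply: normcD_le => //.
rewrite normcM -mulrA ler_wpM2l ?normc_ge0//.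
by apply: le_trans (expi_lip _ _) _; rewrite -mulrBr normrM mulrA.
Qed.

Lemma continuous_Re_trigpoly s : continuous (fun t => complex.Re (trigpoly s t)).
Proof.
have [C C0 HC] := trigpoly_lip s.
move=> t; apply/cvgrPdist_le => e e0; near=> u.
apply: (@le_trans _ _ (C * `|t - u|)).
  by rewrite -cReN -cReD; exact: le_trans (normr_Re_le _) (HC _ _).
apply: (@le_trans _ _ ((C + 1) * (e / (C + 1)))); last first.
  by rewrite mulrC divfK// gt_eqF// ltr_wpDl.
apply: ler_pM => //; first by rewrite lerDl.
near: u; apply: (@cvgr_dist_le _ _ _ (nbhs t) _ id t) => //.
by rewrite divr_gt0// ltr_wpDl.
Unshelve. all: by end_near. Qed.

Lemma trigmean_nil : trigmean [::] = 0.
Proof. by rewrite /trigmean big_nil. Qed.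

Lemma trigmean_cat s q : trigmean (s ++ q) = trigmean s + trigmean q.
Proof. by rewrite /trigmean big_cat. Qed.

Lemma trigmean_scale a s : trigmean (trigscale a s) = a * trigmean s.
Proof. by rewrite /trigmean /trigscale big_map mulr_sumr. Qed.

Lemma trigmean_shift t s : trigmean (trigshift t s) = trigmean s.
Proof.
rewrite /trigmean /trigshift big_map; apply: eq_bigr => p /= /eqP ->.
by rewrite mul0r expi0 mulr1.
Qed.

(** [e^(i l t)] with [l <> 0] has a bounded antiderivative. Over an interval of
    length [L] the average thus differs from the mean by [O(1 / L)], uniformly in
    the position of the interval. *)
Lemma trigpoly_antiderivative s : exists (H : R -> R) (C : R),
  (forall t : R, is_derive t 1 H
    (complex.Re (trigpoly s t) - complex.Re (trigmean s))) /\
  (forall t, `|H t| <= C).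
Proof.
elim: s => [|[[x y] l] s [H [C [dH HC]]]].
  exists (fun=> 0), 0; split=> t; last by rewrite normr0.
  by rewrite trigpoly_nil trigmean_nil subrr; exact: is_derive_cst.
have [l0|l0] := eqVneq l 0.
  exists H, C; split=> // t; rewrite trigpoly_cons /trigmean big_cons/= l0 eqxx.
  rewrite mul0r expi0 mulr1 !cReD opprD addrACA subrr add0r; exact: dH.
exists (fun t => (x * sin (l * t) + y * cos (l * t)) / l + H t).
exists ((`|x| + `|y|) / `|l| + C); split=> t.
  have dl : is_derive t 1 ( *%R l) l.
    have : is_derive t 1 (l *: (@id R)) (l *: (1 : R)) by exact: is_deriveZ.
    by rewrite /GRing.scale/= mulr1.
  have ds : is_derive t 1 (fun u => sin (l * u)) (l * cos (l * t)).
    rewrite mulrC; exact: (@is_derive1_comp _ sin ( *%R l)).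
  have dc : is_derive t 1 (fun u => cos (l * u)) (l * - sin (l * t)).
    rewrite mulrC; exact: (@is_derive1_comp _ cos ( *%R l)).
  have -> : (fun u => (x * sin (l * u) + y * cos (l * u)) / l + H u) =
    ((x / l) *: (fun u => sin (l * u))) + ((y / l) *: (fun u => cos (l * u)))
    + H.
    by apply/funext => u; rewrite !fctE /= /GRing.scale /=; field.
  rewrite trigpoly_cons /trigmean big_cons/= (negPf l0) cReD cReM/=.
  rewrite -[X in is_derive _ _ _ X]addrA.
  have -> : x * cos (l * t) - y * sin (l * t) =
    (x / l) *: (l * cos (l * t)) + (y / l) *: (l * - sin (l * t)).
    by rewrite /GRing.scale /=; field.
  exact: (is_deriveD (is_deriveD (is_deriveZ (x / l) ds) (is_deriveZ (y / l) dc)) (dH t)).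
apply: le_trans (ler_normD _ _) _; apply: lerD => //.
rewrite normrM normfV ler_wpM2r ?invr_ge0//.
apply: le_trans (ler_normD _ _) _; rewrite !normrM.
apply: lerD; rewrite ler_piMr// ler_norml.
  by rewrite sin_geN1 sin_le1.
by rewrite cos_geN1 cos_le1.
Qed.

(** By the mean value theorem, the average over a window is a value taken in
    that window. *)
Lemma trigpoly_window s (e : R) : 0 < e -> exists2 L : R, 0 < L & forall a : R,
  exists2 t : R, `[a, a + L]%classic t &
    complex.Re (trigmean s) - e <= complex.Re (trigpoly s t).
Proof.
move=> e0; have [H [C [dH HC]]] := trigpoly_antiderivative s.
have C0 : 0 <= C by apply: le_trans (HC 0).
pose L := 2 * C / e + 1.
have L0 : 0 < L by rewrite ltr_wpDl// mulr_ge0// ?mulr_ge0// invr_ge0 ltW.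
exists L => // a.
have [||c cin Hc] := @MVT_segment R H _ a (a + L) _ (fun t _ => dH t).
- by rewrite lerDl ltW.
- by apply: derivable_within_continuous => t _; have [] := dH t.
exists c => //; rewrite lerBlDr -lerBlDl -(ler_pM2r L0).
rewrite (_ : _ * L = - (H (a + L) - H a)); last by rewrite Hc; ring.
have eL : 2 * C <= e * L by rewrite /L mulrDr mulr1 mulrCA mulfV ?gt_eqF// mulr1 lerDl ltW.
apply: le_trans eL; rewrite opprB; apply: le_trans (ler_norm _) _.
by apply: le_trans (ler_normB _ _) _; rewrite mulr2n mulrDl mul1r lerD.
Qed.

Lemma ravg_trigpoly s (e : R) : 0 < e -> \forall l \near +oo%R,
  `|ravg l (fun t => complex.Re (trigpoly s t)) - complex.Re (trigmean s)| <= e.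
Proof.
move=> e0; have [H [C [dH HC]]] := trigpoly_antiderivative s.
have C0 : 0 <= C by apply: le_trans (HC 0).
near=> l.
have l0 : 0 < l by near: l; exact: nbhs_pinfty_gt.
have [Lr _] := locally_integrableC_trigpoly s.
set m := complex.Re (trigmean s).
have -> : ravg l (fun t => complex.Re (trigpoly s t)) - m =
    ravg l (fun t => complex.Re (trigpoly s t) - m).
  rewrite ravgD//; last exact: locally_integrable_cst.
  by rewrite ravg_cst.
have cH : continuous H.
  by move=> t; apply: differentiable_continuous; apply/derivable1_diffP; have [] := dH t.
have cW : continuous (fun t => complex.Re (trigpoly s t) - m).
  by move=> t; apply: cvgB; [exact: continuous_Re_trigpoly|exact: cvg_cst].
rewrite /ravg /Rintegral (@continuous_FTC2 _ _ H)//=; first last.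
- by move=> t _; rewrite derive1E; exact: (@derive_val _ _ _ _ _ _ _ (dH t)).
- split.
  + by move=> t _; have [] := dH t.
  + by apply: cvg_at_right_filter; exact: cH.
  + by apply: cvg_at_left_filter; exact: cH.
- by apply: continuous_subspaceT => t; exact: cW.
- by rewrite (lt_trans _ l0)// oppr_lt0.
have l2 : 0 < 2 * l by rewrite mulr_gt0.
rewrite normrM normfV (gtr0_norm l2) ler_pdivrMl//.
apply: le_trans (ler_normB _ _) _; apply: (@le_trans _ _ (C + C)); first exact: lerD.
rewrite (_ : C + C = 2 * C); last by ring.
rewrite -mulrA ler_pM2l// -ler_pdivrMr//.
Unshelve. all: by end_near. Qed.

End TrigPoly.

(** * The Besicovitch seminorm and mean values *)

Section MeanValues.
Context {R : realType}.
Notation mu := (@lebesgue_measure R).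
Notation LI := (locally_integrable setT).
Notation LC := locally_integrableC.
Notation B := (besicovitch_fun R).
Implicit Types (h k : R -> R) (f g : R -> R[i]) (l c e t : R) (z m : R[i]).
Implicit Types (s q : seq (R[i] * R)).

(** A real-valued form of bounds on the seminorm: the averages of locally
    integrable functions are finite. *)
Definition eventually_le f c := \forall l \near +oo, ravg l (fun t => normc (f t)) <= c.

Lemma ravgE f l : LC f -> (((2 * l)^-1)%:E *
    \int[mu]_(t in `[(- l)%R, l]) (normc (f t))%:E)%E =
  (ravg l (fun t => normc (f t)))%:E.
Proof.
move=> Lf; rewrite /ravg EFinM; congr (_ * _)%E; rewrite /Rintegral fineK//.
by apply: integrable_fin_num => //; exact/locally_integrable_itv/locally_integrable_normc.
Qed.

Lemma bes_seminorm_lt_eventually f c : LC f ->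
  (bes_seminorm f < c%:E)%E -> eventually_le f c.
Proof.
move=> Lf; rewrite /bes_seminorm limf_esupE => /ereal_inf_lt[_ [V FV <-] Vc].
apply: filterS FV => l Vl; rewrite -lee_fin -ravgE//.
by apply: le_trans (ltW Vc); apply: ereal_sup_ubound; exists l.
Qed.

Lemma bes_seminorm_le_eventually f c : LC f ->
  eventually_le f c -> (bes_seminorm f <= c%:E)%E.
Proof.
move=> Lf fc; rewrite /bes_seminorm limf_esupE.
set V := [set l | ravg l (fun t => normc (f t)) <= c].
apply: (@le_trans _ _ (ereal_sup ((fun l : R => (((2 * l)^-1)%:E *
    \int[mu]_(t in `[(- l)%R, l]) (normc (f t))%:E)%E) @` V))).
  by apply: ereal_inf_lbound; exists V.
by apply: ge_ereal_sup => _ [l Vl <-]; rewrite ravgE// lee_fin.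
Qed.

Lemma bes_seminorm_eq0P f : LC f ->
  bes_seminorm f = 0%E <-> forall e, 0 < e -> eventually_le f e.
Proof.
move=> Lf; split=> [f0 e e0|h].
  by apply: bes_seminorm_lt_eventually => //; rewrite f0 lte_fin.
apply/eqP; rewrite eq_le bes_seminorm_ge0 andbT.
apply/lee_addgt0Pr => e e0; rewrite add0e.
by apply: bes_seminorm_le_eventually => //; exact: h.
Qed.

Lemma besicovitch_funP f :
  B f <-> LC f /\ forall e, 0 < e -> exists s, eventually_le (f \- trigpoly s) e.
Proof.
split=> [[Lf fs]|[Lf fs]]; split=> // e e0.
  have [s sP] := fs e e0; exists s; apply: bes_seminorm_lt_eventually => //.
  by apply: locally_integrableCB => //; exact: locally_integrableC_trigpoly.
have e2 : 0 < e / 2 by rewrite divr_gt0.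
have [s sP] := fs _ e2; exists s.
apply: (@le_lt_trans _ _ (e / 2)%:E); last first.
  by rewrite lte_fin ltr_pdivrMr// ltr_pMr// ltr1n.
apply: bes_seminorm_le_eventually => //.
by apply: locally_integrableCB => //; exact: locally_integrableC_trigpoly.
Qed.

Lemma besicovitch_funL f : B f -> LC f.
Proof. by case. Qed.

Lemma eventually_leD f g c e : LC f -> LC g ->
  eventually_le f c -> eventually_le g e -> eventually_le (f \+ g) (c + e).
Proof.
move=> Lf Lg fc ge; near=> l.
have l0 : 0 < l by near: l; exact: nbhs_pinfty_gt.
apply: (@le_trans _ _ (ravg l (fun t => normc (f t) + normc (g t)))).
  apply: ravg_le => //; [| |by move=> t; exact: le_normcD].
  - exact/locally_integrable_normc/locally_integrableCD.
  - by apply: locally_integrableD; exact: locally_integrable_normc.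
rewrite ravgD; [|exact: locally_integrable_normc..].
by apply: lerD; near: l.
Unshelve. all: by end_near. Qed.

Lemma eventually_leN f c : eventually_le f c -> eventually_le (\- f) c.
Proof.
rewrite /eventually_le (_ : (fun t => normc ((\- f) t)) = (fun t => normc (f t)))//.
by apply/funext => t; rewrite /= normcN.
Qed.

Lemma eventually_leS f g a c : 0 <= a -> LC f -> LC g ->
  (forall t, normc (g t) <= a * normc (f t)) ->
  eventually_le f c -> eventually_le g (a * c).
Proof.
move=> a0 Lf Lg gf fc; near=> l.
have l0 : 0 < l by near: l; exact: nbhs_pinfty_gt.
apply: (@le_trans _ _ (ravg l (fun t => a * normc (f t)))).
  apply: ravg_le => //; first exact: locally_integrable_normc.
  exact/locally_integrableZ/locally_integrable_normc.
rewrite ravgZ; last exact: locally_integrable_normc.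
by rewrite ler_wpM2l//; near: l.
Unshelve. all: by end_near. Qed.

Lemma eventually_le_sup f c : LC f -> (forall t, normc (f t) <= c) ->
  eventually_le f c.
Proof.
move=> Lf fc; near=> l.
have l0 : 0 < l by near: l; exact: nbhs_pinfty_gt.
rewrite -[leRHS](ravg_cst c l0); apply: ravg_le => //.
  exact: locally_integrable_normc.
exact: locally_integrable_cst.
Unshelve. all: by end_near. Qed.

Lemma eventually_le_translate f c e a : LC f -> c < e ->
  eventually_le f c -> eventually_le (fun t => f (t + a)) e.
Proof.
move=> Lf ce fc.
have fca : \forall l \near +oo, ravg (l + `|a|) (fun t => normc (f t)) <= c.
  case: fc => M [Mr HM]; exists M; split=> // l Ml; apply: HM.
  by rewrite (lt_le_trans Ml)// lerDl.
near=> l.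
have l0 : 0 < l by near: l; exact: nbhs_pinfty_gt.
have fcl : ravg (l + `|a|) (fun t => normc (f t)) <= c by near: l.
have c0 : 0 <= c.
  by apply: le_trans fcl; apply: ravg_ge0 => [|t]; rewrite ?normc_ge0// ltr_pwDl.
have fa := ravg_translate a l0 (locally_integrable_normc Lf)
  (fun t => normc_ge0 (f t)).
apply: le_trans fa _.
apply: (@le_trans _ _ ((l + `|a|) / l * c)).
  by rewrite ler_wpM2l// divr_ge0 ?(ltW l0)// addr_ge0 ?(ltW l0).
have -> : (l + `|a|) / l * c = c + `|a| * c / l by field; rewrite gt_eqF.
rewrite -lerBrDl ler_pdivrMr// -ler_pdivrMl ?subr_gt0//.
Unshelve. all: by end_near. Qed.

Definition has_mean f m := forall e, 0 < e ->
  \forall l \near +oo, normc (cavg l f - m) <= e.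

Lemma bohr_meanE f m : has_mean f m -> bohr_mean f = m.
Proof.
move=> fm; rewrite /bohr_mean.
have -> : (fun l : R => ((2 * l)^-1)%:C *
    ((\int[mu]_(t in `[- l, l]) complex.Re (f t)) +i*
     (\int[mu]_(t in `[- l, l]) complex.Im (f t))) : R[i]^o) =
    (fun l : R => cavg l f : R[i]^o).
  by apply/funext => l; apply: complexP; rewrite ?cReM ?cImM/= /ravg; ring.
apply: (@cvg_lim R[i]^o); first exact: (@norm_hausdorff _ R[i]^o).
apply/cvgrPdist_le => -[x y]; rewrite ltcE/= => /andP[/eqP -> x0].
apply: filterS (fm _ x0) => l.
by rewrite -[`|_|]/((normc (m - cavg l f))%:C) lecR normcBC.
Qed.

Lemma has_mean_unique f m z : has_mean f m -> has_mean f z -> m = z.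
Proof. by move=> /bohr_meanE <- /bohr_meanE. Qed.

Lemma has_meanD f g m z : LC f -> LC g ->
  has_mean f m -> has_mean g z -> has_mean (f \+ g) (m + z).
Proof.
move=> Lf Lg fm gz e e0; have e2 : 0 < e / 2 by rewrite divr_gt0.
near=> l; rewrite cavgD// opprD addrACA (splitr e).
by apply: normcD_le; near: l; [exact: fm|exact: gz].
Unshelve. all: by end_near. Qed.

Lemma has_meanZ a f m : LC f -> has_mean f m ->
  has_mean (fun t => a * f t) (a * m).
Proof.
move=> Lf fm e e0.
have a1 : 0 < normc a + 1 by rewrite ltr_wpDl ?normc_ge0.
have e2 : 0 < e / (normc a + 1) by rewrite divr_gt0.
near=> l; rewrite cavgZ// -mulrBr normcM.
apply: (@le_trans _ _ ((normc a + 1) * (e / (normc a + 1)))).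
  by apply: ler_pM; rewrite ?normc_ge0 ?lerDl//; near: l; exact: fm.
by rewrite mulrC divfK// gt_eqF.
Unshelve. all: by end_near. Qed.

Lemma has_meanN f m : LC f -> has_mean f m -> has_mean (\- f) (- m).
Proof.
move=> Lf fm; rewrite -mulN1r.
have -> : \- f = (fun t => -1 * f t) by apply/funext => t; rewrite mulN1r.
exact: has_meanZ.
Qed.

Lemma has_meanB f g m z : LC f -> LC g ->
  has_mean f m -> has_mean g z -> has_mean (f \- g) (m - z).
Proof.
move=> Lf Lg fm gz; apply: has_meanD => //; first exact: locally_integrableCN.
exact: has_meanN.
Qed.

Lemma has_mean_le f m h c : LC f -> LI h -> (forall t, normc (f t) <= h t) ->
  (forall e, 0 < e -> \forall l \near +oo, ravg l h <= c + e) ->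
  has_mean f m -> normc m <= 2 * c.
Proof.
move=> Lf Lh fh hc fm; apply/ler_addgt0Pr => e e0.
have e2 : 0 < e / 4 by rewrite divr_gt0.
suff : \forall l \near +oo_R, normc m <= 2 * c + e by move/filter_ex => [].
near=> l.
have l0 : 0 < l by near: l; exact: nbhs_pinfty_gt.
have -> : m = cavg l f - (cavg l f - m) by ring.
have -> : 2 * c + e = 2 * (c + e / 4) + 2 * (e / 4) by field.
apply: normcB_le.
  apply: le_trans (cavg_norm l0 Lf Lh fh) _.
  by rewrite ler_pM2l//; near: l; exact: hc.
apply: (@le_trans _ _ (e / 4)); first by near: l; exact: fm.
by rewrite ler_peMl ?ler1n// ltW.
Unshelve. all: by end_near. Qed.

Lemma has_mean_eventually_le f m c : LC f -> eventually_le f c ->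
  has_mean f m -> normc m <= 2 * c.
Proof.
move=> Lf fc; apply: has_mean_le (locally_integrable_normc Lf) _ _ => // e e0.
by near=> l; apply: (@le_trans _ _ c); [near: l|rewrite lerDl ltW].
Unshelve. all: by end_near. Qed.

Lemma has_mean_trigpoly s : has_mean (trigpoly s) (trigmean s).
Proof.
move=> e e0; have e2 : 0 < e / 2 by rewrite divr_gt0.
near=> l.
apply: le_trans (normc_le_ReIm _) _; rewrite cReD cImD cReN cImN /cavg/= (splitr e).
apply: lerD; first by near: l; exact: ravg_trigpoly.
have ImE z : complex.Im z = complex.Re ((0 -i* 1) * z).
  by case: z => x y; rewrite cReM/=; ring.
rewrite [complex.Im (trigmean s)]ImE -trigmean_scale.
under [X in ravg _ X]eq_fun do rewrite ImE -trigpoly_scale.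
by near: l; exact: ravg_trigpoly.
Unshelve. all: by end_near. Qed.

(** The means of approximating trigonometric polynomials form a Cauchy
    sequence, since the mean is Lipschitz for the seminorm. *)
Lemma besicovitch_has_mean f : B f -> exists m, has_mean f m.
Proof.
move=> /besicovitch_funP[Lf fs].
have ek (k : nat) : 0 < (k.+1%:R^-1 / 2 / 2 : R) by rewrite !divr_gt0.
pose sk (k : nat) := projT1 (cid (fs _ (ek k))).
have skP (k : nat) : eventually_le (f \- trigpoly (sk k)) (k.+1%:R^-1 / 2 / 2).
  exact: (projT2 (cid (fs _ (ek k)))).
have Ls (k : nat) := locally_integrableC_trigpoly (sk k).
have [m hm] : exists m : unit -> R[i], forall (k : nat) (t : unit),
    normc (m t - trigmean (sk k)) <= k.+1%:R^-1.
  apply: uniform_cauchy_lim => k j _.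
  have -> : k.+1%:R^-1 + j.+1%:R^-1 =
      2 * (j.+1%:R^-1 / 2 / 2 + k.+1%:R^-1 / 2 / 2) + (k.+1%:R^-1 / 2 + j.+1%:R^-1 / 2) :> R.
    by move: (k.+1%:R^-1) (j.+1%:R^-1) => x y; field.
  apply: (@le_trans _ _ (2 * (j.+1%:R^-1 / 2 / 2 + k.+1%:R^-1 / 2 / 2))); last first.
    by rewrite lerDl addr_ge0// divr_ge0// invr_ge0.
  apply: (@has_mean_eventually_le (trigpoly (sk k) \- trigpoly (sk j))).
  - exact: locally_integrableCB.
  - have -> : trigpoly (sk k) \- trigpoly (sk j) =
        (f \- trigpoly (sk j)) \+ (\- (f \- trigpoly (sk k))).
      by apply/funext => t /=; ring.
    apply: eventually_leD => //; [exact: locally_integrableCB| |].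
      exact/locally_integrableCN/locally_integrableCB.
    exact: eventually_leN.
  - by apply: has_meanB => //; exact: has_mean_trigpoly.
exists (m tt) => e e0.
have [k ke] := invS_lt (divr_gt0 e0 (ltr0n _ 3)).
have e3 : 0 < e / 3 by rewrite divr_gt0.
near=> l.
have l0 : 0 < l by near: l; exact: nbhs_pinfty_gt.
have -> : e = (e / 3 + e / 3) + e / 3 by field.
apply: (@normc_dist_le _ (trigmean (sk k))); last first.
  by rewrite normcBC; exact: le_trans (hm k tt) (ltW ke).
apply: (@normc_dist_le _ (cavg l (trigpoly (sk k)))); last first.
  by near: l; exact: has_mean_trigpoly.
rewrite -cavgB//; apply: le_trans (cavg_norm l0 _ _ (fun t => lexx _)) _.
- exact: locally_integrableCB.
- exact/locally_integrable_normc/locally_integrableCB.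
apply: le_trans (ltW ke).
apply: (@le_trans _ _ (2 * (k.+1%:R^-1 / 2 / 2))).
  by rewrite ler_pM2l//; near: l; exact: skP.
by rewrite mulrC divfK// ler_pdivrMr// ler_peMr ?invr_ge0// ler1n.
Unshelve. all: by end_near. Qed.

Lemma besicovitch_fun_trigpoly s : B (trigpoly s).
Proof.
apply/besicovitch_funP; split=> [|e e0]; first exact: locally_integrableC_trigpoly.
exists s; apply: eventually_le_sup.
  by apply: locally_integrableCB; exact: locally_integrableC_trigpoly.
by move=> t /=; rewrite subrr normc0 ltW.
Qed.

Lemma besicovitch_funB f g : B f -> B g -> B (f \- g).
Proof. by move=> Bf Bg; exact: besicovitch_funD Bf (besicovitch_funN Bg). Qed.

Lemma besicovitch_fun_mul f s : B f -> B (f \* trigpoly s).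
Proof.
move=> /besicovitch_funP[Lf fs].
have Lfs : LC (f \* trigpoly s).
  by apply: locally_integrableCM (trigpoly_bound s) => //; exact: measurableC_trigpoly.
apply/besicovitch_funP; split=> // e e0.
pose C := \sum_(p <- s) normc p.1 + 1.
have C0 : 0 < C by rewrite ltr_wpDl// sumr_ge0// => p _; exact: normc_ge0.
have [q qP] := fs _ (divr_gt0 e0 C0); exists (trigmul q s).
have -> : e = C * (e / C) by rewrite mulrC divfK// gt_eqF.
apply: eventually_leS qP; first exact: ltW.
- by apply: locally_integrableCB => //; exact: locally_integrableC_trigpoly.
- by apply: locally_integrableCB => //; exact: locally_integrableC_trigpoly.
move=> t /=; rewrite trigpoly_mul -mulrBl normcM mulrC ler_wpM2r ?normc_ge0//.
by apply: le_trans (trigpoly_bound _ _) _; rewrite lerDl.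
Qed.

Lemma besicovitch_fun_translate f a : B f -> B (fun t => f (t + a)).
Proof.
move=> /besicovitch_funP[Lf fs]; apply/besicovitch_funP; split.
  exact: locally_integrableC_translate.
move=> e e0; have e2 : 0 < e / 2 by rewrite divr_gt0.
have [s sP] := fs _ e2; exists (trigshift a s).
have -> : (fun t => f (t + a)) \- trigpoly (trigshift a s) =
    (fun t => (f \- trigpoly s) (t + a)).
  by apply/funext => t /=; rewrite trigpoly_shift.
apply: eventually_le_translate sP.
  by apply: locally_integrableCB => //; exact: locally_integrableC_trigpoly.
by rewrite ltr_pdivrMr// ltr_pMr// ltr1n.
Qed.

Lemma besicovitch_fun_uniform f : measurableC f ->
  (forall e, 0 < e -> exists2 g, B g & forall t, normc (f t - g t) <= e) -> B f.
Proof.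
move=> mf hf.
have Lf : LC f.
  have [g Bg fg] := hf 1 ltr01.
  apply: (@locally_integrableC_le _ _ (fun t => 1 + normc (g t))) => //.
    apply: locally_integrableD; first exact: locally_integrable_cst.
    exact/locally_integrable_normc/besicovitch_funL.
  by move=> t; rewrite -[f t](subrK (g t)); apply: normcD_le.
apply/besicovitch_funP; split=> // e e0.
have e2 : 0 < e / 2 by rewrite divr_gt0.
have [g /besicovitch_funP[Lg gs] fg] := hf _ e2; have [s sP] := gs _ e2.
exists s.
have -> : f \- trigpoly s = (f \- g) \+ (g \- trigpoly s).
  by apply/funext => t /=; rewrite subrKA.
rewrite (splitr e); apply: eventually_leD => //.
- exact: locally_integrableCB.
- by apply: locally_integrableCB => //; exact: locally_integrableC_trigpoly.
- by apply: eventually_le_sup => //; exact: locally_integrableCB.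
Qed.

End MeanValues.

(** * Kronecker's theorem and concentrated kernels *)

Section Concentration.
Context {R : realType}.
Implicit Types (s q : seq (R * R)) (J : seq R) (t x : R).

Definition twist (psi : R -> R) s : seq (R[i] * R) :=
  [seq (p.1%:C * expi (psi p.2), p.2) | p <- s].

Definition rmul s q : seq (R * R) := [seq (p.1 * r.1, p.2 + r.2) | p <- s, r <- q].

Definition coef_sum s := \sum_(p <- s) p.1.

Definition nonneg_coefs s := all (fun p => 0 <= p.1) s.

Lemma coef_sum_mul s q : coef_sum (rmul s q) = coef_sum s * coef_sum q.
Proof.
rewrite /coef_sum /rmul big_allpairs_dep mulr_suml.
by apply: eq_bigr => p _; rewrite mulr_sumr.
Qed.

Lemma nonneg_coefs_mul s q :
  nonneg_coefs s -> nonneg_coefs q -> nonneg_coefs (rmul s q).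
Proof.
move=> /allP s0 /allP q0; apply/allP => _ /allpairsP[[p r] [/= ps rq ->]].
by apply: mulr_ge0; [exact: s0|exact: q0].
Qed.

(** Cauchy-Schwarz, read off from the variance of the coefficients. *)
Lemma sqr_coef_sum_le s :
  coef_sum s ^+ 2 <= (size s)%:R * \sum_(p <- s) p.1 ^+ 2.
Proof.
have [->|s0] := eqVneq s [::].
  by rewrite /coef_sum !big_nil expr0n/= mulr0.
set n : R := (size s)%:R; have n0 : 0 < n by rewrite ltr0n lt0n size_eq0.
set c := coef_sum s / n.
have : 0 <= \sum_(p <- s) (p.1 - c) ^+ 2.
  by apply: sumr_ge0 => p _; exact: sqr_ge0.
have -> : \sum_(p <- s) (p.1 - c) ^+ 2 =
    \sum_(p <- s) p.1 ^+ 2 - 2 * c * coef_sum s + n * c ^+ 2.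
  rewrite /coef_sum /n; elim: (s) (c) => [|p r ih] d.
    by rewrite !big_nil/=; ring.
  by rewrite !big_cons ih/= -natr1; ring.
rewrite -(pmulr_rge0 _ n0).
have -> : n * (\sum_(p <- s) p.1 ^+ 2 - 2 * c * coef_sum s + n * c ^+ 2) =
    n * (\sum_(p <- s) p.1 ^+ 2) - coef_sum s ^+ 2.
  by rewrite /c; field; rewrite gt_eqF.
by rewrite subr_ge0.
Qed.

(** Only pairs of equal frequencies contribute to the mean of [|A|^2]; for
    them the twisting factors cancel. This is why the mean does not depend on
    [psi], and why it is at least the sum of the squared coefficients when these
    are nonnegative. *)
Lemma trigmean_sqr_twist psi s : nonneg_coefs s -> exists2 m,
  trigmean (trigmul (twist psi s) (trigconj (twist psi s))) = m%:C &
  \sum_(p <- s) p.1 ^+ 2 <= m.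
Proof.
move=> s0.
exists (\sum_(p <- s) p.1 * \sum_(r <- s | r.2 == p.2) r.1).
  rewrite /trigmean big_mkcond big_allpairs_dep rmorph_sum big_map.
  apply: eq_bigr => p _.
  rewrite /trigconj !big_map rmorphM rmorph_sum mulr_sumr [RHS]big_mkcond.
  apply: eq_bigr => r _; rewrite subr_eq0 eq_sym.
  case: eqVneq => [rp|_]; last by [].
  transitivity (p.1%:C * expi (psi p.2) * conjc (r.1%:C * expi (psi r.2))) => //.
  rewrite (rp : r.2 = p.2) cconjM -expiN mulrACA expiVN mulr1.
  by congr (_ * _); apply: complexP; rewrite /= ?oppr0.
rewrite big_seq [leRHS]big_seq; apply: ler_sum => p ps.
rewrite expr2 ler_wpM2l ?(allP s0 _ ps)//.
rewrite (big_rem p ps)/= eqxx lerDl big_seq_cond.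
by apply: sumr_ge0 => r /andP[/mem_rem/(allP s0)].
Qed.

Section Additive.
Variables (V : set R) (psi : R -> R).
Hypotheses (V0 : V 0) (VD : forall x y, V x -> V y -> V (x + y)).
Hypothesis psiD : forall x y, V x -> V y -> psi (x + y) = psi x + psi y.

Definition freqs_in s := forall p, p \in s -> V p.2.

Lemma additive_psi0 : psi 0 = 0.
Proof.
by have /eqP := psiD V0 V0; rewrite addr0 -subr_eq0 opprD addrA subrr sub0r oppr_eq0 => /eqP.
Qed.

Lemma freqs_in_mul s q : freqs_in s -> freqs_in q -> freqs_in (rmul s q).
Proof. by move=> sV qV _ /allpairsP[[p r] [/= ps rq ->]]; apply: VD; auto. Qed.

Lemma trigpoly_twist_mul s q t : freqs_in s -> freqs_in q ->
  trigpoly (twist psi (rmul s q)) t = trigpoly (twist psi s) t * trigpoly (twist psi q) t.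
Proof.
move=> sV qV; rewrite /trigpoly /twist !big_map big_allpairs_dep mulr_suml.
rewrite big_seq [RHS]big_seq; apply: eq_bigr => p /sV pV.
rewrite mulr_sumr big_seq [RHS]big_seq; apply: eq_bigr => r /qV rV /=.
rewrite psiD// !expiD mulrDl expiD rmorphM /=; ring.
Qed.

End Additive.

(** The coefficients of [(1 + e^(i l t))^N]. *)
Definition binom_factor N (l : R) : seq (R * R) :=
  [seq ('C(N, k)%:R, l *+ k) | k <- iota 0 N.+1].

Definition binom_product N J : seq (R * R) :=
  foldr (fun l => rmul (binom_factor N l)) [:: (1, 0)] J.

Lemma size_binom_product N J : size (binom_product N J) = (N.+1 ^ size J)%N.
Proof.
by elim: J => //= l J ih; rewrite size_allpairs size_map size_iota ih expnS.
Qed.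

Lemma coef_sum_binom_product N J : coef_sum (binom_product N J) = 2 ^+ (N * size J).
Proof.
elim: J => [|l J ih]; first by rewrite /coef_sum big_seq1 muln0 expr0.
rewrite /= coef_sum_mul ih mulnS exprD; congr (_ * _).
rewrite /coef_sum big_map (_ : 2 = 1 + 1)// exprDn.
rewrite -[iota 0 N.+1]/(index_iota 0 N.+1) big_mkord.
by apply: eq_bigr => k _; rewrite !expr1n mulr1.
Qed.

Lemma nonneg_binom_product N J : nonneg_coefs (binom_product N J).
Proof.
elim: J => [|l J ih]; first by rewrite /= ler01.
by apply: nonneg_coefs_mul => //; apply/allP => _ /mapP[k _ ->] /=.
Qed.

Definition bump J (psi : R -> R) t : R :=
  \prod_(l <- J) ((1 + cos (l * t + psi l)) / 2).

Lemma bump_factor_itv x : 0 <= (1 + cos x) / 2 <= 1.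
Proof.
have := cos_geN1 x; have := cos_le1 x.
by move: (cos x) => c; lra.
Qed.

Lemma bump_itv J psi t : 0 <= bump J psi t <= 1.
Proof.
rewrite /bump; elim: J => [|l J /andP[u0 u1]]; first by rewrite big_nil ler01 lexx.
rewrite big_cons; have /andP[c0 c1] := bump_factor_itv (l * t + psi l).
by rewrite mulr_ge0//= mulr_ile1.
Qed.

Lemma bump_le_factor J psi t l : l \in J ->
  bump J psi t <= (1 + cos (l * t + psi l)) / 2.
Proof.
move=> lJ; rewrite /bump (big_rem l lJ)/=.
have /andP[c0 _] := bump_factor_itv (l * t + psi l).
by rewrite ler_piMr//; have /andP[] := bump_itv (rem l J) psi t.
Qed.

Lemma sqr_normc_1expi x : normc (1 + expi x) ^+ 2 = 4 * ((1 + cos x) / 2).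
Proof.
rewrite sqr_normc2 /=; have := cos2Dsin2 x.
move: (cos x) (sin x) => c d h.
rewrite (_ : _ + _ = 1 + 2 * c + (c ^+ 2 + d ^+ 2)); last by ring.
by rewrite h; field.
Qed.

Lemma trigpoly_binom_product (V : set R) (psi : R -> R) N J t :
  V 0 -> (forall x y, V x -> V y -> V (x + y)) ->
  (forall x y, V x -> V y -> psi (x + y) = psi x + psi y) ->
  (forall l, l \in J -> V l) ->
  freqs_in V (binom_product N J) /\ trigpoly (twist psi (binom_product N J)) t =
    \prod_(l <- J) (1 + expi (l * t + psi l)) ^+ N.
Proof.
move=> V0 VD psiD; have psi0 := additive_psi0 V0 psiD.
have Vn l k : V l -> V (l *+ k) /\ psi (l *+ k) = psi l *+ k.
  move=> Vl; elim: k => [|k [ih1 ih2]]; first by rewrite !mulr0n.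
  by rewrite !mulrS psiD// ih2; split=> //; exact: VD.
elim: J => [|l J ih] JV.
  split; first by move=> p; rewrite inE => /eqP ->.
  by rewrite big_nil /trigpoly big_seq1/= psi0 mul0r expi0 !mulr1.
have [fJ tJ] := ih (fun x xJ => JV x (mem_behead (s := l :: J) xJ)).
have Vl : V l by apply: JV; rewrite mem_head.
have fl : freqs_in V (binom_factor N l).
  by move=> _ /mapP[k _ ->] /=; have [] := Vn l k Vl.
split; first exact: (freqs_in_mul VD fl fJ).
rewrite /= (trigpoly_twist_mul psiD)// tJ big_cons; congr (_ * _).
rewrite /trigpoly !big_map exprDn -[iota 0 N.+1]/(index_iota 0 N.+1) big_mkord.
apply: eq_bigr => k _ /=; have [_ ->] := Vn l k Vl.
rewrite expr1n mul1r -mulrA -expiD.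
have -> : psi l *+ k + l *+ k * t = (l * t + psi l) *+ k.
  by rewrite mulrnDl mulrnAl addrC.
have expiX x j : expi (x *+ j) = expi x ^+ j :> R[i].
  by elim: j => [|j ihj]; rewrite ?expi0// mulrS exprS expiD ihj.
by rewrite expiX -[RHS]mulr_natl; congr (_ * _); exact: rmorph_nat.
Qed.

(** [bump^N] is [4^(- N #J) |A|^2], where [A] is a twisted binomial product
    whose untwisted coefficients sum to [2^(N #J)]. By Cauchy-Schwarz the sum
    of their squares is at least [4^(N #J)] over the number [(N + 1)^#J] of
    frequencies, so that the mean of [bump^N] decays only polynomially in [N]. *)
Lemma bump_power (V : set R) (psi : R -> R) N J :
  V 0 -> (forall x y, V x -> V y -> V (x + y)) ->
  (forall x y, V x -> V y -> psi (x + y) = psi x + psi y) ->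
  (forall l, l \in J -> V l) ->
  exists S m, [/\ forall t, trigpoly S t = (bump J psi t ^+ N)%:C,
    trigmean S = m%:C & N.+1%:R ^- size J <= m].
Proof.
move=> V0 VD psiD JV; set G := binom_product N J; set A := twist psi G.
have [m mE mG] := trigmean_sqr_twist psi (nonneg_binom_product N J).
set d : R := 4 ^+ (N * size J); have d0 : 0 < d by rewrite exprn_gt0.
exists (trigscale (d^-1)%:C (trigmul A (trigconj A))), (d^-1 * m); split.
- move=> t; rewrite trigpoly_scale trigpoly_mul trigpoly_conj mul_conj -rmorphM.
  congr (_%:C); have [_ ->] := trigpoly_binom_product N t V0 VD psiD JV.
  rewrite /d /bump; elim: (J) => [|l r ih].
    by rewrite !big_nil muln0 expr0 normc1 invr1 mul1r !expr1n.
  rewrite !big_cons mulnS exprD [in RHS]exprMn -ih normcM exprMn invfM mulrACA.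
  congr (_ * _).
  have -> : normc ((1 + expi (l * t + psi l)) ^+ N) = normc (1 + expi (l * t + psi l)) ^+ N.
    by elim: (N) => [|k ihk]; rewrite ?normc1// !exprS normcM ihk.
  rewrite -exprM mulnC exprM sqr_normc_1expi exprMn mulrA mulVf ?mul1r//.
- by rewrite trigmean_scale mE -rmorphM.
have Gm : d <= N.+1%:R ^+ size J * m.
  apply: le_trans (ler_wpM2l _ mG); last by rewrite exprn_ge0.
  have := sqr_coef_sum_le G.
  rewrite coef_sum_binom_product size_binom_product natrX.
  by rewrite -exprM mulnC exprM expr2 -natrM.
have X0 : 0 < N.+1%:R ^+ size J :> R by rewrite exprn_gt0.
by rewrite [leRHS]mulrC ler_pdivlMr// [leLHS]mulrC ler_pdivrMr// mulrC.
Qed.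

Lemma exp_below_poly n (d : R) : 0 < d <= 1 -> exists N, (1 - d) ^+ N < N.+1%:R ^- n.
Proof.
move=> /andP[d0 d1].
(* with N = (n + 1) M, Bernoulli's inequality turns (1 - d)^N into the
   power n + 1 of a quantity of order 1 / M, one power more than needed *)
have bern M : (1 - d) ^+ M * (1 + M%:R * d) <= 1.
  elim: M => [|M ih]; first by rewrite expr0 mul0r addr0 mul1r.
  apply: le_trans ih; rewrite exprSr -mulrA ler_wpM2l ?exprn_ge0 ?subr_ge0//.
  rewrite -natr1 (_ : (1 - d) * (1 + (M%:R + 1) * d) =
    1 + M%:R * d - d ^+ 2 * (M%:R + 1)); last by ring.
  by rewrite lerBlDr lerDl mulr_ge0 ?sqr_ge0// addr_ge0.
pose X : R := n.+1%:R / d; have X0 : 0 < X by rewrite divr_gt0.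
have [M XM] : exists M : nat, X ^+ n / d < M%:R.
  by exists (Num.truncn (X ^+ n / d)).+1; exact: truncnS_gt.
set a := (1 - d) ^+ M; set b := 1 + M%:R * d.
have a0 : 0 <= a by rewrite exprn_ge0// subr_ge0.
have ab : a * b <= 1 := bern M.
have Xb : X ^+ n < b by rewrite ltr_pdivrMr// in XM; rewrite (lt_trans XM)// /b ltrDr.
have b0 : 0 < b by rewrite (le_lt_trans _ Xb)// exprn_ge0// ltW.
exists (M * n.+1)%N.
have N0 : 0 < (M * n.+1).+1%:R ^+ n :> R by rewrite exprn_gt0.
rewrite -[ltRHS]mul1r ltr_pdivlMr//.
have NX : (M * n.+1).+1%:R <= X * b.
  apply: (@le_trans _ _ (n.+1%:R * M.+1%:R)).
    by rewrite -natrM ler_nat mulnC mulnS -addn1 addnC leq_add2r.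
  rewrite /X -mulrA ler_wpM2l// mulrC ler_pdivlMr// /b -natr1 mulrDl mul1r.
  by rewrite addrC lerD2r.
rewrite exprM -/a exprSr.
apply: (@le_lt_trans _ _ (a ^+ n * a * (X * b) ^+ n)).
  rewrite ler_wpM2l//; first by rewrite mulr_ge0// exprn_ge0.
  by apply: lerXn2r; rewrite ?nnegrE ?ler0n// mulr_ge0// ltW.
have -> : a ^+ n * a * (X * b) ^+ n = (a * b) ^+ n * (a * X ^+ n).
  by rewrite !exprMn; ring.
apply: (@le_lt_trans _ _ (a * X ^+ n)).
  apply: ler_piMl; first by rewrite mulr_ge0// exprn_ge0// ltW.
  by apply: exprn_ile1 => //; rewrite mulr_ge0// ltW.
have [->|an0] := eqVneq a 0; first by rewrite mul0r.
apply: lt_le_trans ab; rewrite ltr_pM2l// lt_neqAle eq_sym an0; exact: a0.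
Qed.

Lemma bump_small_close J (psi : R -> R) t l (e : R) : l \in J -> 0 <= e ->
  1 - e ^+ 2 / 4 <= bump J psi t -> normc (expi (l * t) - expi (- psi l)) <= e.
Proof.
move=> lJ e0 /le_trans/(_ (bump_le_factor psi t lJ)) h.
rewrite -ler_sqr ?nnegrE ?normc_ge0//.
have -> : expi (l * t) - expi (- psi l) = expi (- psi l) * (expi (l * t + psi l) - 1) :> R[i].
  by rewrite mulrBr mulr1 -expiD; congr (expi _ - _); ring.
rewrite normcM normc_expi mul1r sqr_normc2 /=.
have := cos2Dsin2 (l * t + psi l); move: h.
move: (cos _) (sin _) => c d h cd.
rewrite (_ : _ + _ = 1 - 2 * c + (c ^+ 2 + d ^+ 2)); last by ring.
by rewrite cd; lra.
Qed.

(** In a long window the average of [bump^N] is nearly its mean, far larger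
    than [(1 - d)^N] for a suitable [N]; so [bump] exceeds [1 - d] somewhere in
    the window, which makes all the phases close. *)
Theorem kronecker (V : set R) (psi : R -> R) J (e : R) :
  V 0 -> (forall x y, V x -> V y -> V (x + y)) ->
  (forall x y, V x -> V y -> psi (x + y) = psi x + psi y) ->
  (forall l, l \in J -> V l) -> 0 < e ->
  exists2 L, 0 < L & forall a, exists2 t, `[a, a + L]%classic t &
    forall l, l \in J -> normc (expi (l * t) - expi (psi l)) <= e.
Proof.
move=> V0 VD psiD JV e0.
pose d := Num.min 1 (e ^+ 2 / 4).
have d0 : 0 < d <= 1 by rewrite lt_min ltr01 divr_gt0 ?exprn_gt0//= ge_min lexx.
have [N HN] := exp_below_poly (size J) d0.
pose phi x := - psi x.
have phiD x y : V x -> V y -> phi (x + y) = phi x + phi y.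
  by move=> Vx Vy; rewrite /phi psiD// opprD.
have [S [m [SE mE Nm]]] := bump_power N V0 VD phiD JV.
have dm : 0 < m - (1 - d) ^+ N by rewrite subr_gt0 (lt_le_trans HN).
have [L L0 HL] := trigpoly_window S dm; exists L => // a.
have [t tin] := HL a; rewrite mE SE /= opprB addrC subrK => ht.
exists t => // l lJ; rewrite -[psi l]opprK -/(phi l).
apply: (bump_small_close lJ); first exact: ltW.
apply: (@le_trans _ _ (1 - d)); first by rewrite lerD2l lerN2 ge_min lexx orbT.
rewrite leNgt; apply/negP => ud; move: ht; apply/negP; rewrite -ltNge.
have /andP[u0 _] := bump_itv J phi t.
rewrite ltr_pXn2r// ?nnegrE// ?subr_ge0; last by case/andP: d0.
case: (N) HN => // ; rewrite expr0 -[X in _ < X]/(1 ^- _) expr1n invr1 ltxx//.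
Qed.

(** The kernel is a power of [bump] divided by its mean. For [l] in [J],
    [|e^(i l t) - 1|^2] is at most [4 (1 - bump t)], and the mean of
    [bump^N (1 - bump)] is small relative to that of [bump^N] whenever two
    successive means are nearly equal. *)
Theorem concentrated_kernel J (e : R) : 0 < e -> exists K k,
  [/\ forall t, trigpoly K t = (k t)%:C, forall t, 0 <= k t, trigmean K = 1 &
    forall A c C, 0 <= c -> 0 <= C -> (forall t, normc (trigpoly A t) <=
      c + C * \sum_(l <- J) normc (expi (l * t) - 1) ^+ 2) ->
    normc (trigmean (trigmul K A)) <= 2 * (c + C * e)].
Proof.
move=> e0; pose psi (x : R) : R := 0.
have hS N : exists Sm : seq (R[i] * R) * R,
    [/\ forall t, trigpoly Sm.1 t = (bump J psi t ^+ N)%:C,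
    trigmean Sm.1 = Sm.2%:C & N.+1%:R ^- size J <= Sm.2].
  have [| | | |S [m Sm]] := @bump_power setT psi N J => //.
    by move=> x y _ _; rewrite /psi addr0.
  by exists (S, m).
pose S N := (projT1 (cid (hS N))).1; pose m N := (projT1 (cid (hS N))).2.
have [SE mE mN] : [/\ forall N t, trigpoly (S N) t = (bump J psi t ^+ N)%:C,
    forall N, trigmean (S N) = (m N)%:C & forall N, N.+1%:R ^- size J <= m N].
  by split=> N *; have [] := projT2 (cid (hS N)).
have m0 N : 0 < m N by apply: lt_le_trans (mN N); rewrite invr_gt0 exprn_gt0.
pose n := size J; pose d : R := Num.min 1 (e / (4 * n.+1%:R)).
have d0 : 0 < d <= 1.
  by rewrite lt_min ltr01 divr_gt0//= ?ge_min ?lexx// mulr_gt0.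
(* otherwise the means would decay exponentially *)
have [N HN] : exists N, (1 - d) * m N <= m N.+1.
  apply: contrapT => /forallNP H.
  have [N] := exp_below_poly n d0; apply/negP; rewrite -leNgt.
  apply: le_trans (mN N) _.
  have m1 : m 0%N = 1.
    suff : (m 0%N)%:C = 1 :> R[i] by case.
    rewrite -mE; apply: (has_mean_unique (has_mean_trigpoly _)).
    rewrite (_ : trigpoly (S 0%N) = trigpoly [:: (1, 0)]); last first.
      by apply/funext => t; rewrite SE expr0 trigpoly_cst.
    rewrite [X in has_mean _ X](_ : 1 = trigmean [:: (1, 0 : R)]).
      exact: has_mean_trigpoly.
    by rewrite /trigmean big_cons big_nil/= eqxx addr0.
  elim: N => [|N ih]; first by rewrite m1 expr0.
  rewrite exprS; apply: (@le_trans _ _ ((1 - d) * m N)).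
    by apply/ltW; rewrite ltNge; apply/negP/H.
  by rewrite ler_wpM2l// subr_ge0; case/andP: d0.
exists (trigscale ((m N)^-1)%:C (S N)), (fun t => (m N)^-1 * bump J psi t ^+ N).
have u0 t := proj1 (andP (bump_itv J psi t)).
split.
- by move=> t; rewrite trigpoly_scale SE rmorphM.
- by move=> t; rewrite mulr_ge0 ?exprn_ge0// invr_ge0 ltW.
- by rewrite trigmean_scale mE -rmorphM mulVf// gt_eqF.
move=> A c C c0 C0 HA.
set K := trigscale _ _.
pose D := 4 * C * n%:R.
have D0 : 0 <= D by rewrite mulr_ge0// mulr_ge0.
pose E := trigscale ((m N)^-1 * (c + D))%:C (S N) ++
  trigscale (- ((m N)^-1 * D))%:C (S N.+1).
have EE t : complex.Re (trigpoly E t) =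
    (m N)^-1 * bump J psi t ^+ N * (c + D * (1 - bump J psi t)).
  by rewrite trigpoly_catE !trigpoly_scale !SE -!rmorphM -rmorphD/= exprSr; ring.
have LE : locally_integrable setT (fun t => complex.Re (trigpoly E t)).
  by have [] := locally_integrableC_trigpoly E.
apply: (has_mean_le (locally_integrableC_trigpoly (trigmul K A)) LE _ _ (has_mean_trigpoly _)).
- move=> t; rewrite EE trigpoly_mul normcM trigpoly_scale SE -rmorphM normc_real.
  rewrite ger0_norm; last by rewrite mulr_ge0 ?exprn_ge0// invr_ge0 ltW.
  apply: ler_wpM2l; first by rewrite mulr_ge0 ?exprn_ge0// invr_ge0 ltW.
  apply: le_trans (HA t) _; rewrite lerD2l.
  rewrite (_ : D * _ = C * (4 * (1 - bump J psi t) * n%:R)); last by rewrite /D; ring.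
  rewrite ler_wpM2l//; apply: (@le_trans _ _ (\sum_(l <- J) (4 * (1 - bump J psi t)))).
    rewrite big_seq [leRHS]big_seq; apply: ler_sum => l lJ.
    have := bump_le_factor psi t lJ; have := cos2Dsin2 (l * t).
    rewrite sqr_normc2 /= /psi addr0; move: (cos _) (sin _) (bump _ _ _) => x y u xy ux.
    by rewrite !expr2 in xy *; lra.
  by rewrite big_const_seq count_predT iter_addr_0 mulr_natr.
move=> x x0; apply: filterS (ravg_trigpoly E x0) => l.
rewrite ler_norml => /andP[_]; rewrite lerBlDr => /le_trans; apply.
rewrite addrC lerD2r trigmean_cat !trigmean_scale !mE -!rmorphM -rmorphD/=.
have -> : (m N)^-1 * (c + D) * m N + - ((m N)^-1 * D) * m N.+1 =
    c + D * (1 - m N.+1 / m N) by field; rewrite gt_eqF.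
rewrite lerD2l; apply: (@le_trans _ _ (D * d)).
  by rewrite ler_wpM2l// lerBlDr addrC -lerBlDr ler_pdivlMr.
apply: (@le_trans _ _ (D * (e / (4 * n.+1%:R)))).
  by rewrite ler_wpM2l// ge_min lexx orbT.
have -> : D * (e / (4 * n.+1%:R)) = C * e * (n%:R / n.+1%:R).
  have : n.+1%:R != 0 :> R by rewrite pnatr_eq0.
  by rewrite /D; move: (n.+1%:R) (n%:R) => x' y' x'0; field.
rewrite ler_piMr//; first by rewrite mulr_ge0// ltW.
by rewrite ler_pdivrMr// mul1r ler_nat.
Qed.

End Concentration.

(** * Fourier coefficients and the uniqueness theorem *)

Section Uniqueness.
Context {R : realType}.
Notation LC := locally_integrableC.
Notation B := (besicovitch_fun R).
Implicit Types (f g : R -> R[i]) (l e t : R) (m z : R[i]).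
Implicit Types (s : seq (R[i] * R)) (x y : besicovitch R).

(** With [v = |P| / C], the iteration is that of the classical approximation
    of [sqrt (v^2)] by polynomials in [v^2]; the trigonometric polynomial
    obtained approximates the conjugate of the sign of [P]. *)
Lemma sign_multiplier s e : 0 < e -> exists phi,
  (forall t, normc (trigpoly phi t) <= 1) /\
  (forall t, normc (trigpoly s t) - e <=
             complex.Re (trigpoly s t * trigpoly phi t)).
Proof.
move=> e0; pose C := \sum_(p <- s) normc p.1 + 1.
have C0 : 0 < C by rewrite ltr_wpDl// sumr_ge0// => p _; exact: normc_ge0.
pose v t := normc (trigpoly s t) / C.
have v0 t : 0 <= v t by rewrite divr_ge0 ?normc_ge0// ltW.
have v1 t : v t <= 1.
  by rewrite ler_pdivrMr// mul1r (le_trans (trigpoly_bound _ _))// lerDl.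
have Q n : exists q w, [/\ forall t, trigpoly q t = (w t)%:C,
    forall t, 0 <= v t * w t <= 1 &
    forall t, (1 - v t * w t) * (1 + n%:R * (v t / 2)) <= 1].
  elim: n => [|n [q [w [qw w01 wn]]]].
    exists [::], (fun=> 0); split=> t; first by rewrite trigpoly_nil.
      by rewrite mulr0 lexx ler01.
    by rewrite mulr0 subr0 mul0r addr0 mulr1.
  exists (q ++ (2^-1%:C, 0) :: trigscale (- (2 * C ^+ 2)^-1)%:C
    (trigmul (trigmul s (trigconj s)) (trigmul q q))).
  exists (fun t => w t + (2^-1 - v t ^+ 2 * w t ^+ 2 / 2)); split=> t.
  - rewrite trigpoly_catE trigpoly_cons /= mul0r expi0 mulr1 trigpoly_scale.
    rewrite !trigpoly_mul trigpoly_conj mul_conj !qw -!rmorphM -!rmorphD.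
    by congr (_%:C); rewrite /v; field; rewrite gt_eqF.
  - have := v0 t; have := v1 t; have := w01 t.
    move: (v t) (w t) => a b; set u := a * b => /andP[u0 u1] a1 a0.
    rewrite (_ : a * _ = u + a * (1 - u ^+ 2) / 2); last by rewrite /u; ring.
    have -> : u + a * (1 - u ^+ 2) / 2 = 1 - (1 - u) * (1 - a * (1 + u) / 2).
      by field.
    have : 0 <= a * (1 + u) / 2 <= 1.
      rewrite divr_ge0 ?mulr_ge0 ?addr_ge0//= ler_pdivrMr// mul1r.
      by rewrite -[leRHS]mul1r ler_pM ?addr_ge0// (_ : 2 = 1 + 1)// lerD.
    move: (a * (1 + u) / 2) => c /andP[c0 c1].
    rewrite subr_ge0 lerBlDr lerDl mulr_ge0 ?subr_ge0//= andbT.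
    by rewrite mulr_ile1 ?subr_ge0// gerBl.
  have := v0 t; have := v1 t; have := w01 t; have := wn t.
  move: (v t) (w t) => a b; set u := a * b => un /andP[u0 u1] a1 a0.
  apply: le_trans un.
  rewrite (_ : 1 - a * _ = (1 - u) * (1 - a * (1 + u) / 2)); last by rewrite /u; field.
  rewrite -mulrA ler_wpM2l ?subr_ge0//.
  apply: (@le_trans _ _ ((1 - a / 2) * (1 + n.+1%:R * (a / 2)))).
    rewrite ler_wpM2r ?addr_ge0 ?mulr_ge0// lerD2l lerN2 ler_wpM2r ?invr_ge0//.
    by rewrite ler_peMr// lerDl.
  have -> : (1 - a / 2) * (1 + n.+1%:R * (a / 2)) =
      1 + n%:R * (a / 2) - (n%:R + 1) * (a / 2) ^+ 2 by rewrite -natr1; field.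
  by rewrite gerBl mulr_ge0 ?sqr_ge0// addr_ge0.
have [n ne] := invS_lt (divr_gt0 e0 (mulr_gt0 (ltr0n R 2) C0)).
have [q [w [qw w01 wn]]] := Q n.+1.
exists (trigscale C^-1%:C (trigmul (trigconj s) q)); split=> t.
  rewrite trigpoly_scale trigpoly_mul trigpoly_conj qw normcM normcM normc_conj.
  rewrite !normc_real normfV (gtr0_norm C0) mulrA [_^-1 * _]mulrC -/(v t).
  by rewrite -(ger0_norm (v0 t)) -normrM ger0_norm; have /andP[] := w01 t.
rewrite trigpoly_scale trigpoly_mul trigpoly_conj qw.
have -> : trigpoly s t * ((C^-1)%:C * (conjc (trigpoly s t) * (w t)%:C)) =
    (C * (v t * (v t * w t)))%:C.
  rewrite mulrCA [_ * (conjc _ * _)]mulrA mul_conj -!rmorphM; congr (_%:C).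
  by rewrite /v; field; rewrite gt_eqF.
rewrite /= lerBlDr -lerBlDl.
rewrite (_ : normc _ = C * v t); last by rewrite /v mulrC divfK// gt_eqF.
rewrite -mulrBr -ler_pdivlMl//.
have vn : v t * (1 - v t * w t) * n.+1%:R <= 2.
  have := wn t; have /andP[_] := w01 t; have := v0 t.
  by move: (v t * w t) (v t) (n.+1%:R) => u a k a0 u1 h; lra.
move: vn; rewrite -ler_pdivlMr// mulrBr mulr1 => /le_trans; apply.
have -> : C^-1 * e = 2 * (e / (2 * C)) by field; rewrite gt_eqF.
by rewrite ler_pM2l// ltW.
Qed.

Lemma has_mean_null f : LC f -> bes_seminorm f = 0%E -> has_mean f 0.
Proof.
move=> Lf /(bes_seminorm_eq0P Lf) f0 e e0.
have e2 : 0 < e / 2 by rewrite divr_gt0.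
near=> l.
have l0 : 0 < l by near: l; exact: nbhs_pinfty_gt.
rewrite subr0.
apply: le_trans (cavg_norm l0 Lf (locally_integrable_normc Lf) (fun t => lexx _)) _.
by rewrite -ler_pdivlMl// mulrC; near: l; exact: f0.
Unshelve. all: by end_near. Qed.

Lemma representatives_besicovitch x f : representatives x f -> B f.
Proof. by move=> [u _ <-]; exact: set_valP. Qed.

Lemma representatives_null x f g : representatives x f -> representatives x g ->
  bes_seminorm (f \- g) = 0%E.
Proof.
move=> [u /= ux <-] [v /= vx <-].
by have /eqmodP/asboolP := etrans ux (esym vx).
Qed.

Lemma representatives_inj x y f : representatives x f -> representatives y f ->
  x = y.
Proof.
move=> [u /= <- uf] [v /= <- vf]; congr (\pi _)%qT; apply: val_inj.
exact: etrans uf (esym vf).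
Qed.

(** The coefficient, defined through one chosen representative, may be computed
    with any other. *)
Lemma has_mean_fourier_coef x g l : representatives x g ->
  has_mean (fun t => g t * expi (- (l * t))) (fourier_coef x l).
Proof.
move=> xg; set f := val (repr x); have xf : representatives x f := representatives_repr x.
have expiE : (fun t => expi (- (l * t))) = trigpoly [:: (1, - l)] :> (R -> R[i]).
  by apply/funext => t; rewrite trigpoly1 mul1r mulNr.
have Bf := representatives_besicovitch xf; have Bg := representatives_besicovitch xg.
have Be h : B h -> B (fun t => h t * expi (- (l * t))).
  by move=> /(besicovitch_fun_mul [:: (1, - l)]); rewrite -expiE.
have [m fm] := besicovitch_has_mean (Be f Bf).
rewrite /fourier_coef (bohr_meanE fm).
have L1 := besicovitch_funL (Be f Bf).
have L2 := besicovitch_funL (Be _ (besicovitch_funB Bg Bf)).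
rewrite -[m]addr0 (_ : (fun t => g t * _) = (fun t => f t * expi (- (l * t))) \+
    (fun t => (g \- f) t * expi (- (l * t)))); last first.
  by apply/funext => t /=; rewrite -mulrDl addrC subrK.
apply: has_meanD => //; apply: has_mean_null => //.
have /(bes_seminorm_eq0P (besicovitch_funL (besicovitch_funB Bg Bf))) gf0 :=
  representatives_null xg xf.
apply/(bes_seminorm_eq0P L2) => e /gf0 gf; rewrite -[e]mul1r.
apply: (eventually_leS ler01 _ L2 _ gf).
  exact: besicovitch_funL (besicovitch_funB Bg Bf).
by move=> t /=; rewrite normcM normc_expi mulr1 mul1r.
Qed.

(** The mean of the product of a class by a trigonometric polynomial, as a
    finite combination of Fourier coefficients. *)
Definition pairing x s : R[i] := \sum_(p <- s) p.1 * fourier_coef x (- p.2).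

Lemma has_mean_pairing x g s : representatives x g ->
  has_mean (g \* trigpoly s) (pairing x s).
Proof.
move=> xg; have Bg := representatives_besicovitch xg.
elim: s => [|[a l] s ih].
  rewrite /pairing big_nil -trigmean_nil.
  rewrite (_ : g \* _ = trigpoly [::]); first exact: has_mean_trigpoly.
  by apply/funext => t; rewrite /= trigpoly_nil mulr0.
rewrite /pairing big_cons /=.
have LM q := besicovitch_funL (besicovitch_fun_mul q Bg).
have h := has_mean_fourier_coef (- l) xg.
have E : (fun t => g t * expi (- (- l * t))) = g \* trigpoly [:: (1, l)].
  by apply/funext => t /=; rewrite trigpoly1 mul1r mulNr opprK.
rewrite (_ : g \* _ = (fun t => a * (g t * expi (- (- l * t)))) \+ (g \* trigpoly s)).
  apply: has_meanD => //.
  - rewrite (_ : (fun t => _) = g \* trigpoly [:: (a, l)])//.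
    by apply/funext => t /=; rewrite trigpoly1 mulNr opprK mulrCA.
  - by apply: has_meanZ => //; rewrite E.
by apply/funext => t /=; rewrite trigpoly_cons mulNr opprK /=; ring.
Qed.

(** With [P] close to [f] and [phi] the approximate sign of [P], the averages of
    [|P|] are close to those of [P phi], hence to those of [f phi], which tend
    to [0]. *)
Lemma null_of_means f : B f -> (forall s, has_mean (f \* trigpoly s) 0) ->
  bes_seminorm f = 0%E.
Proof.
move=> /besicovitch_funP[Lf fs] f0; apply/(bes_seminorm_eq0P Lf) => e e0.
have e5 : 0 < e / 5 by rewrite divr_gt0.
have [s sP] := fs _ e5; have [phi [phi1 phiP]] := sign_multiplier s e5.
have Ls := locally_integrableC_trigpoly s.
have Lfs : LC (f \- trigpoly s) by exact: locally_integrableCB.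
have mphi := measurableC_trigpoly phi.
have Lmul h : LC h -> LC (h \* trigpoly phi).
  by move=> Lh; apply: locally_integrableCM mphi phi1.
have -> : f = (f \- trigpoly s) \+ trigpoly s.
  by apply/funext => t /=; rewrite subrK.
have -> : e = e / 5 + (4 * (e / 5)) by field.
apply: eventually_leD => //.
near=> l.
have l0 : 0 < l by near: l; exact: nbhs_pinfty_gt.
have Lre : locally_integrable setT (fun t => complex.Re (trigpoly s t * trigpoly phi t)).
  by have [] := Lmul _ Ls.
have h1 : ravg l (fun t => normc (trigpoly s t)) <=
    complex.Re (cavg l (trigpoly s \* trigpoly phi)) + e / 5.
  rewrite -[X in _ + X](ravg_cst (e / 5) l0) -ravgD//; last exact: locally_integrable_cst.
  apply: ravg_le => //; first exact: locally_integrable_normc.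
    by apply: locally_integrableD => //; exact: locally_integrable_cst.
  by move=> t; rewrite -lerBlDr.
have h2 : normc (cavg l ((f \- trigpoly s) \* trigpoly phi)) <= 2 * (e / 5).
  apply: le_trans (cavg_norm l0 _ (locally_integrable_normc Lfs) _) _.
  - exact: Lmul.
  - by move=> t /=; rewrite normcM ler_piMr ?normc_ge0.
  by rewrite ler_pM2l//; near: l; exact: sP.
have h3 : normc (cavg l (f \* trigpoly phi)) <= e / 5.
  by rewrite -[cavg l _]subr0; near: l; exact: f0.
apply: le_trans h1 _; rewrite (_ : 4 * (e / 5) = e / 5 + 2 * (e / 5) + e / 5); last by field.
rewrite lerD2r; apply: le_trans (ler_norm _) _; apply: le_trans (normr_Re_le _) _.
rewrite (_ : trigpoly s \* _ = (f \* trigpoly phi) \- ((f \- trigpoly s) \* trigpoly phi)).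
  by rewrite cavgB; [exact: normcB_le|exact: Lmul|exact: Lmul].
by apply/funext => t /=; ring.
Unshelve. all: by end_near. Qed.

Theorem fourier_uniqueness x y :
  (forall l, fourier_coef x l = fourier_coef y l) -> x = y.
Proof.
move=> xy; set f := val (repr x); set g := val (repr y).
have xf : representatives x f := representatives_repr x.
have yg : representatives y g := representatives_repr y.
have Bf := representatives_besicovitch xf; have Bg := representatives_besicovitch yg.
apply: (@representatives_inj x y g) => //; apply: (representatives_eqv xf) => //.
apply: null_of_means; first exact: besicovitch_funB.
move=> s; rewrite (_ : _ \* _ = (f \* trigpoly s) \- (g \* trigpoly s)); last first.
  by apply/funext => t /=; rewrite mulrBl.
rewrite -(subrr (pairing x s)).
have {2}-> : pairing x s = pairing y s by apply: eq_bigr => p _; rewrite xy.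
by apply: has_meanB; [exact: besicovitch_funL (besicovitch_fun_mul _ _)..|
  exact: has_mean_pairing|exact: has_mean_pairing].
Qed.

End Uniqueness.

(** * Translates of a class *)

Section Translates.
Context {R : realType}.
Notation LC := locally_integrableC.
Notation B := (besicovitch_fun R).
Implicit Types (f g : R -> R[i]) (l e t a c : R) (m z : R[i]).
Implicit Types (s : seq (R[i] * R)) (x y : besicovitch R).

Definition bes_class f (Bf : B f) : besicovitch R :=
  (\pi_(besicovitch R) (SigSub (mem_set Bf) : besicovitch_fun R))%qT.

Lemma representatives_class f (Bf : B f) : representatives (bes_class Bf) f.
Proof. by exists (SigSub (mem_set Bf)). Qed.

Definition shift a x : besicovitch R :=
  bes_class (besicovitch_fun_translate a (representatives_besicovitch (representatives_repr x))).

Lemma representatives_shift a x g : representatives x g ->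
  representatives (shift a x) (fun t => g (t + a)).
Proof.
move=> xg; have Bg := representatives_besicovitch xg.
have xf := representatives_repr x; have Bf := representatives_besicovitch xf.
apply: (representatives_eqv (representatives_class _)).
  exact: besicovitch_fun_translate.
have Lfg := besicovitch_funL (besicovitch_funB Bf Bg).
have /(bes_seminorm_eq0P Lfg) fg0 := representatives_null xf xg.
apply/(bes_seminorm_eq0P (locally_integrableC_translate a Lfg)) => e e0.
apply: (@eventually_le_translate _ _ (e / 2)) => //.
  by rewrite ltr_pdivrMr// ltr_pMr// ltr1n.
by apply: fg0; rewrite divr_gt0.
Qed.

Lemma translatesE x : translates x = range (shift ^~ x).
Proof.
apply/seteqP; split=> [y [a [f xf yf]]|_ [a _ <-]].
  by exists a => //; exact: (representatives_inj (representatives_shift a xf)).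
exists a, (val (repr x)); first exact: representatives_repr.
exact/representatives_shift/representatives_repr.
Qed.

Lemma shiftD a b x : shift a (shift b x) = shift (a + b) x.
Proof.
have xf := representatives_repr x.
apply: (representatives_inj (representatives_shift a (representatives_shift b xf))).
have := representatives_shift (a + b) xf.
by under eq_fun do rewrite addrA.
Qed.

Lemma shift0 x : shift 0 x = x.
Proof.
have xf := representatives_repr x.
apply: (representatives_inj (representatives_shift 0 xf)).
by under eq_fun do rewrite addr0.
Qed.

(** True for trigonometric polynomials, and stable under approximation because
    the seminorm is translation invariant. *)
Lemma has_mean_translate f a m : B f -> has_mean f m ->
  has_mean (fun t => f (t + a)) m.
Proof.
move=> Bf fm; have Bfa := besicovitch_fun_translate a Bf.
have [m' fm'] := besicovitch_has_mean Bfa.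
suff -> : m = m' by [].
apply/eqP; rewrite -subr_eq0; apply/eqP; apply: normc_small0 => e e0.
have e6 : 0 < e / 6 by rewrite divr_gt0.
have [/= Lf fs] := (besicovitch_funP f).1 Bf; have [s sP] := fs _ e6.
have Ls := locally_integrableC_trigpoly s.
have Lsa := locally_integrableC_trigpoly (trigshift a s).
have -> : e = 2 * (e / 6) + 2 * (2 * (e / 6)) by field.
apply: (@normc_dist_le _ (trigmean s)).
  apply: has_mean_eventually_le sP (has_meanB Lf Ls fm (has_mean_trigpoly s)).
  exact: locally_integrableCB.
rewrite normcBC -(trigmean_shift a s).
apply: (@has_mean_eventually_le _ ((fun t => f (t + a)) \- trigpoly (trigshift a s))).
- by apply: locally_integrableCB => //; exact: besicovitch_funL.
- rewrite (_ : _ \- _ = (fun t => (f \- trigpoly s) (t + a))); last first.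
    by apply/funext => t /=; rewrite trigpoly_shift.
  apply: eventually_le_translate sP; first exact: locally_integrableCB.
  by rewrite ltr_pMl// ltr1n.
- by apply: has_meanB => //; [exact: besicovitch_funL|exact: has_mean_trigpoly].
Qed.

Lemma fourier_coef_shift a x l :
  fourier_coef (shift a x) l = expi (l * a) * fourier_coef x l.
Proof.
have xf := representatives_repr x; set f := val (repr x) in xf.
have h := has_mean_fourier_coef l xf.
have Be : B (fun t => f t * expi (- (l * t))).
  have -> : (fun t => f t * expi (- (l * t))) = f \* trigpoly [:: (1, - l)].
    by apply/funext => t /=; rewrite trigpoly1 mul1r mulNr.
  by apply: besicovitch_fun_mul; exact: representatives_besicovitch xf.
have h1 := has_mean_fourier_coef l (representatives_shift a xf).
have h2 := has_meanZ (expi (l * a)) (besicovitch_funL (besicovitch_fun_translate a Be))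
  (has_mean_translate a Be h).
apply: has_mean_unique h1 _; move: h2; congr has_mean; apply/funext => t.
by rewrite mulrCA -expiD; congr (_ * expi _); ring.
Qed.

Lemma bes_ball_sup x y e : bes_ball x e y -> exists f g,
  [/\ representatives x f, representatives y g & forall t, normc (f t - g t) <= e].
Proof.
move=> /bes_ballP[f [g [xf yg fg]]]; exists f, g; split=> // t.
rewrite -lee_fin; apply: le_trans (ltW fg).
by apply: ereal_sup_ubound; exists t.
Qed.

Lemma sup_bes_ball x y f g c e : representatives x f -> representatives y g ->
  (forall t, normc (f t - g t) <= c) -> c < e -> bes_ball x e y.
Proof.
move=> xf yg fg ce; apply/bes_ballP; exists f, g; split=> //.
apply: (@le_lt_trans _ _ c%:E); last by rewrite lte_fin.
by apply: ge_ereal_sup => _ [t _ <-]; rewrite lee_fin.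
Qed.

Lemma bes_ball_shift a x y e : bes_ball x e y -> bes_ball (shift a x) e (shift a y).
Proof.
move=> /bes_ballP[f [g [xf yg fg]]]; apply/bes_ballP.
exists (fun t => f (t + a)), (fun t => g (t + a)).
split; [exact: representatives_shift..|].
apply: le_lt_trans fg; apply: ge_ereal_sup => _ [t _ <-].
by apply: ereal_sup_ubound; exists (t + a).
Qed.

(** The role of [k] is that of [|s|], which need not be a trigonometric
    polynomial: the bound involves the mean of [k] rather than the supremum of
    [s], so that it stays of order [e] for concentrated [s]. *)
Lemma pairing_dist x y e s k : bes_ball x e y ->
  (forall t, normc (trigpoly s t) <= complex.Re (trigpoly k t)) ->
  normc (pairing x s - pairing y s) <= 2 * (e * complex.Re (trigmean k)).
Proof.
move=> /bes_ball_sup[f [g [xf yg fg]]] sk.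
have e0 : 0 <= e by apply: le_trans (fg 0); exact: normc_ge0.
have Bf := representatives_besicovitch xf; have Bg := representatives_besicovitch yg.
have LM h q : B h -> LC (h \* trigpoly q) by move=> /(besicovitch_fun_mul q)/besicovitch_funL.
have [Lk _] := locally_integrableC_trigpoly k.
apply: (@has_mean_le _ ((f \* trigpoly s) \- (g \* trigpoly s)) _
  (fun t => e * complex.Re (trigpoly k t))).
- by apply: locally_integrableCB; exact: LM.
- exact: locally_integrableZ.
- by move=> t /=; rewrite -mulrBl normcM ler_pM ?normc_ge0.
- move=> d d0; have d1 : 0 < d / (e + 1) by rewrite divr_gt0// ltr_wpDl.
  apply: filterS (ravg_trigpoly k d1) => l; rewrite ravgZ//.
  rewrite ler_norml => /andP[_]; rewrite lerBlDr => h.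
  apply: le_trans (ler_wpM2l e0 h) _; rewrite mulrDr addrC lerD2l.
  rewrite mulrCA ler_piMr//; first exact: ltW.
  by rewrite ler_pdivrMr ?ltr_wpDl// mul1r lerDl.
- by apply: has_meanB; [exact: LM|exact: LM|exact: has_mean_pairing..].
Qed.

Lemma fourier_coef_dist x y e l : bes_ball x e y ->
  normc (fourier_coef x l - fourier_coef y l) <= 2 * e.
Proof.
move=> xy.
have E u : fourier_coef u l = pairing u [:: (1, - l)].
  by rewrite /pairing big_seq1 mul1r opprK.
rewrite !E; apply: le_trans (pairing_dist (k := [:: (1, 0)]) xy _) _.
  by move=> t; rewrite trigpoly1 trigpoly_cst mul1r normc_expi.
by rewrite /trigmean big_cons big_nil/= eqxx addr0 mulr1.
Qed.

Lemma closure_ballP (A : set (besicovitch R)) y :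
  closure A y <-> forall e, 0 < e -> exists2 z, A z & bes_ball y e z.
Proof.
split=> [Ay e e0|h U /nbhs_ballP[e e0 eU]].
  by have [|z [Az yz]] := Ay (ball y e); [exact: nbhsx_ballx|exists z].
by have [z Az yz] := h e e0; exists z; split=> //; exact: eU.
Qed.

(** A cluster point of translates along which all phases tend to [1] has the
    Fourier coefficients of [x], hence is [x]: on the compact closure, the
    uniform topology is that of convergence of Fourier coefficients. *)
Lemma compact_common_almost_periods x e : compact (closure (translates x)) ->
  0 < e -> exists (J : seq R) (d : R), 0 < d /\ forall t,
    (forall l, l \in J -> normc (expi (l * t) - 1) <= d) -> bes_ball x e (shift t x).
Proof.
move=> cx e0; apply: contrapT => H.
pose D := [set p : seq R * R | 0 < p.2].
pose near_period (p : seq R * R) t := forall l, l \in p.1 -> normc (expi (l * t) - 1) <= p.2.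
pose A (p : seq R * R) := [set shift t x |
  t in [set t | near_period p t /\ ~ bes_ball x e (shift t x)]].
have FF : ProperFilter (filter_from D A).
  apply: filter_from_proper; last first.
    move=> [J d] /= d0; apply: contrapT => A0; apply: H; exists J, d; split=> // t tJ.
    by apply: contrapT => xt; apply: A0; exists (shift t x), t.
  apply: filter_from_filter; first by exists ([::], 1) => /=; exact: ltr01.
  move=> [J1 d1] [J2 d2] /= d10 d20; exists (J1 ++ J2, Num.min d1 d2) => /=.
    by rewrite /D/= lt_min d10.
  move=> _ [t [tJ xt] <-]; split; exists t => //; split=> // l /= lJ.
    by apply: le_trans (tJ l _) _; rewrite /= ?mem_cat ?lJ// ge_min lexx.
  by apply: le_trans (tJ l _) _; rewrite /= ?mem_cat ?lJ ?orbT// ge_min lexx orbT.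
have Fx : filter_from D A (closure (translates x)).
  exists ([::], 1); first exact: ltr01.
  by move=> _ [t _ <-]; apply: subset_closure; rewrite translatesE; exists t.
have [y [_ Fy]] := cx _ FF Fx.
have yx : y = x.
  apply: fourier_uniqueness => l; apply/eqP; rewrite -subr_eq0; apply/eqP.
  apply: normc_small0 => d d0.
  pose M := normc (fourier_coef x l) + 2.
  have M0 : 0 < M by rewrite ltr_wpDl ?normc_ge0.
  have dM : 0 < d / M by rewrite divr_gt0.
  have [|_ [[t [tl _] <-] yt]] := Fy (A ([:: l], d / M)) (ball y (d / M)) _ (nbhsx_ballx _ _ dM).
    by exists ([:: l], d / M).
  have -> : d = 2 * (d / M) + (d / M) * normc (fourier_coef x l).
    by rewrite /M; field; rewrite gt_eqF.
  apply: (@normc_dist_le _ (fourier_coef (shift t x) l)).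
    exact: fourier_coef_dist.
  rewrite fourier_coef_shift -{2}[fourier_coef x l]mul1r -mulrBl normcM.
  by rewrite ler_wpM2r ?normc_ge0// tl// inE.
rewrite {}yx in Fy.
have [|_ [[t [_ xt] <-] /xt]] := Fy (A ([::], 1)) (ball x e) _ (nbhsx_ballx _ _ e0); last by [].
by exists ([::], 1) => //; exact: ltr01.
Qed.

End Translates.

(** * From compactness to almost periodicity *)

Section CompactToAP.
Context {R : realType}.
Notation LC := locally_integrableC.
Notation B := (besicovitch_fun R).
Implicit Types (f g : R -> R[i]) (l e t a c : R) (m z : R[i]).
Implicit Types (s k K : seq (R[i] * R)) (x y : besicovitch R) (J : seq R).

Lemma common_almost_periods J e : 0 < e -> exists2 L, 0 < L &
  forall a, exists2 t, `[a, a + L]%classic t &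
    forall l, l \in J -> normc (expi (l * t) - 1) <= e.
Proof.
move=> e0; have [|||||L L0 HL] := @kronecker R setT (fun=> 0) J e => //.
  by move=> *; rewrite addr0.
exists L => // a; have [t ta tJ] := HL a; exists t => // l lJ.
by rewrite -(@expi0 R); exact: tJ.
Qed.

Lemma bes_ball_mono x y e c : e <= c -> bes_ball x e y -> bes_ball x c y.
Proof. by move=> ec; rewrite /bes_ball/= => /lt_le_trans; apply; rewrite lee_fin. Qed.

(** Distances between classes may be infinite. Small translations move [x] by
    less than [1], so translations by [r] in [[0, L]] move it by a bounded number
    of such steps, and every translation is such an [r] up to an almost
    period. *)
Lemma translates_bounded x : compact (closure (translates x)) ->
  exists2 D, 0 <= D & forall t, bes_ball x D (shift t x).
Proof.
move=> cx; have [J [d [d0 Jd]]] := compact_common_almost_periods cx (@ltr01 R).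
have [L L0 HL] := common_almost_periods J d0.
pose M := 1 + \sum_(l <- J) `|l|.
have M0 : 0 < M by rewrite ltr_pwDl// sumr_ge0.
have small h : 0 <= h -> h <= d / (2 * M) -> bes_ball x 1 (shift h x).
  move=> h0 hd; apply: Jd => l lJ; rewrite -expi0; apply: le_trans (expi_lip _ _) _.
  have lM : `|l| <= M.
    rewrite /M (big_rem l lJ)/= addrCA lerDl addr_ge0// sumr_ge0//.
  rewrite subr0 normrM (ger0_norm h0).
  apply: (@le_trans _ _ (2 * (M * (d / (2 * M))))).
    by rewrite ler_pM2l// ler_pM.
  by rewrite le_eqVlt; apply/orP; left; apply/eqP; field; rewrite gt_eqF.
have steps h n : 0 <= h -> h <= d / (2 * M) -> bes_ball x n.+1%:R (shift (n%:R * h) x).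
  move=> h0 hd; elim: n => [|n ih].
    by rewrite mul0r shift0; exact: bes_ball_center.
  rewrite -[n.+2%:R]natr1 -[in n.+1%:R * h]natr1 mulrDl mul1r -shiftD.
  apply: bes_ball_triangle ih _; apply: bes_ball_shift; exact: small.
have [n nL] : exists n : nat, L / (d / (2 * M)) < n.+1%:R.
  by exists (Num.truncn (L / (d / (2 * M)))); exact: truncnS_gt.
have dM0 : 0 < d / (2 * M) by rewrite divr_gt0// mulr_gt0.
exists (n.+2%:R + 1) => // t; have [u] := HL (t - L).
rewrite /= in_itv/= subrK => /andP[u1 u2] /Jd xu.
apply: (@bes_ball_triangle _ _ (shift (t - u) x)); last first.
  have -> : shift t x = shift (t - u) (shift u x) by rewrite shiftD subrK.
  exact: bes_ball_shift.
have -> : t - u = n.+1%:R * ((t - u) / n.+1%:R) by rewrite mulrC divfK// pnatr_eq0.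
apply: steps; first by rewrite divr_ge0// subr_ge0.
rewrite ler_pdivrMr// -ler_pdivrMl// mulrC; apply: le_trans (ltW nL).
by rewrite ler_wpM2r ?invr_ge0 ?(ltW dM0)// lerBlDr -lerBlDl.
Qed.

(** A bound by a trigonometric polynomial, valid at all [t]: away from the common
    almost periods of [J] the sum is at least [d^2] and the bound [D] on all
    translates takes over. *)
Lemma translates_modulus x e : compact (closure (translates x)) -> 0 < e ->
  exists J C, 0 <= C /\ forall t, bes_ball x
    (e + C * \sum_(l <- J) normc (expi (l * t) - 1) ^+ 2) (shift t x).
Proof.
move=> cx e0; have [D D0 HD] := translates_bounded cx.
have [J [d [d0 Jd]]] := compact_common_almost_periods cx e0.
exists J, (D / d ^+ 2); split; first by rewrite divr_ge0// sqr_ge0.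
move=> t.
have sum0 r : 0 <= \sum_(l <- r) normc (expi (l * t) - 1) ^+ 2.
  by apply: sumr_ge0 => l _; exact: sqr_ge0.
have [tJ|] := pselect (forall l, l \in J -> normc (expi (l * t) - 1) <= d).
  by apply: bes_ball_mono (Jd _ tJ); rewrite lerDl mulr_ge0// divr_ge0// sqr_ge0.
move=> /existsNP[l /not_implyP[lJ /negP]]; rewrite -ltNge => dl.
apply: bes_ball_mono (HD t); apply: (@le_trans _ _ (D / d ^+ 2 * d ^+ 2)).
  by rewrite divfK// expf_neq0// gt_eqF.
apply: (@le_trans _ _ (D / d ^+ 2 * \sum_(l <- J) normc (expi (l * t) - 1) ^+ 2)).
  rewrite ler_wpM2l ?divr_ge0 ?sqr_ge0// (big_rem l lJ)/=.
  by rewrite ler_wpDr// lerXn2r ?nnegrE ?normc_ge0 ?(ltW d0) ?(ltW dl).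
by rewrite lerDr ltW.
Qed.

(** The trigonometric polynomial in [t] that results from averaging
    [x (t + u) * s u] over [u]: a convolution of [x], obtained from finitely many
    of its Fourier coefficients. *)
Definition fourier_filter x s : seq (R[i] * R) :=
  [seq (p.1 * fourier_coef x (- p.2), - p.2) | p <- s].

Lemma fourier_filterE x s t : trigpoly (fourier_filter x s) t = pairing (shift t x) s.
Proof.
rewrite /trigpoly /fourier_filter big_map /pairing; apply: eq_bigr => p _ /=.
by rewrite fourier_coef_shift; ring.
Qed.

(** Fubini for the mean of [x (t + u) * s u * k t] over [t] and [u]. *)
Lemma trigmean_filter_sym x s k :
  trigmean (trigmul k (fourier_filter x s)) = trigmean (trigmul s (fourier_filter x k)).
Proof.
rewrite /trigmean /trigmul ![LHS]big_mkcond ![RHS]big_mkcond !big_allpairs_dep.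
rewrite exchange_big /fourier_filter big_map; apply: eq_bigr => p _.
rewrite big_map; apply: eq_bigr => q _ /=.
rewrite !subr_eq0 eq_sym; case: eqVneq => [->|_]; last by [].
by rewrite mulrCA mulrA mulrC mulrA.
Qed.

Lemma trigmean_ext s k : trigpoly s =1 trigpoly k -> trigmean s = trigmean k.
Proof.
move=> /funext sk; apply: has_mean_unique (has_mean_trigpoly s) _.
rewrite sk; exact: has_mean_trigpoly.
Qed.

Lemma trigmean_mul_sub K s z : trigmean K = 1 ->
  trigmean (trigmul K (s ++ [:: (- z, 0)])) = trigmean (trigmul K s) - z.
Proof.
move=> K1; rewrite (trigmean_ext (k := trigmul K s ++ trigscale (- z) K)).
  by rewrite trigmean_cat trigmean_scale K1 mulr1.
move=> t; rewrite trigpoly_mul !trigpoly_catE trigpoly_mul trigpoly_scale trigpoly_cst.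
by ring.
Qed.

(** Convolution with a concentrated kernel moves [x] little, because [K] puts
    most of its mass on times at which the translate of [x] is close to [x].
    Closeness is tested by duality, against [s] dominated by [k]. *)
Lemma filter_approximation x e : compact (closure (translates x)) -> 0 < e ->
  exists q, forall s k, (forall t, normc (trigpoly s t) <= complex.Re (trigpoly k t)) ->
    normc (trigmean (trigmul s q) - pairing x s) <= e * complex.Re (trigmean k).
Proof.
move=> cx e0; have e8 : 0 < e / 8 by rewrite divr_gt0.
have [J [C [C0 HJ]]] := translates_modulus cx e8.
have d0 : 0 < e / 8 / (C + 1) by rewrite divr_gt0// ltr_wpDl.
have [K [w [KE w0 K1 HK]]] := concentrated_kernel J d0.
exists (fourier_filter x K) => s k sk.
have k0 : 0 <= complex.Re (trigmean k).
  have := pairing_dist (bes_ball_center x (@ltr01 R)) sk.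
  by rewrite subrr normc0 mul1r pmulr_rge0.
rewrite -trigmean_filter_sym -trigmean_mul_sub//.
set mk := complex.Re _ in k0 *.
apply: (@le_trans _ _ (2 * (2 * (e / 8) * mk + 2 * C * mk * (e / 8 / (C + 1))))).
  apply: HK => [||t]; [by rewrite mulr_ge0// mulr_ge0// ltW|by rewrite mulr_ge0// mulr_ge0|].
  rewrite trigpoly_catE trigpoly_cst fourier_filterE normcBC.
  apply: le_trans (pairing_dist (HJ t) sk) _.
  by rewrite -/mk le_eqVlt; apply/orP; left; apply/eqP; ring.
have -> : e * mk = 2 * (2 * (e / 8) * mk + 2 * mk * (e / 8)) by field.
rewrite ler_pM2l// lerD2l (_ : 2 * C * mk * _ = 2 * mk * (e / 8) * (C / (C + 1))); last first.
  by field; rewrite gt_eqF// ltr_wpDl.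
rewrite ler_piMr//; first by rewrite mulr_ge0 ?(ltW e8)// mulr_ge0.
by rewrite ler_pdivrMr ?ltr_wpDl// mul1r lerDl.
Qed.

Lemma trigpoly_translate_le s t a : normc (trigpoly s (t + a) - trigpoly s t) <=
  \sum_(p <- s) normc p.1 * normc (expi (p.2 * a) - 1).
Proof.
rewrite /trigpoly -sumrB; apply: le_trans (normc_sum _ _) _; apply: ler_sum => p _.
rewrite -mulrBr normcM mulrDr expiD -{2}[expi (p.2 * t)]mulr1 -mulrBr normcM.
by rewrite normc_expi mul1r.
Qed.

(** Testing against a kernel centred at [t] recovers the value at [t]. *)
Lemma trigpoly_sup_dual h c :
  (forall s k, (forall t, normc (trigpoly s t) <= complex.Re (trigpoly k t)) ->
    normc (trigmean (trigmul s h)) <= c * complex.Re (trigmean k)) ->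
  forall t, normc (trigpoly h t) <= c.
Proof.
move=> hc t0; apply/ler_addgt0Pr => e e0.
pose S := \sum_(p <- h) normc p.1.
have S0 : 0 <= S by apply: sumr_ge0 => p _; exact: normc_ge0.
pose r := e / (4 * (S + 1)).
have S1 : 0 < S + 1 by rewrite ltr_wpDl.
have r0 : 0 < r by rewrite divr_gt0// mulr_gt0.
pose J := [seq p.2 | p <- h].
have d0 : 0 < r ^+ 2 by rewrite exprn_gt0.
have [K [w [KE w0 K1 HK]]] := concentrated_kernel J d0.
have KS : trigmean (trigmul K (trigshift t0 h)) = trigmean (trigmul (trigshift (- t0) K) h).
  rewrite -[RHS](trigmean_shift t0); apply: trigmean_ext => t.
  by rewrite trigpoly_shift !trigpoly_mul !trigpoly_shift addrK.
have h1 : normc (trigmean (trigmul K (trigshift t0 h))) <= c.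
  rewrite KS -[leRHS]mulr1 (_ : 1 = complex.Re (trigmean (trigshift (- t0) K))); last first.
    by rewrite trigmean_shift K1.
  by apply: hc => t; rewrite trigpoly_shift KE normc_real ger0_norm.
have h2 : normc (trigmean (trigmul K (trigshift t0 h ++ [:: (- trigpoly h t0, 0)]))) <= e.
  apply: (@le_trans _ _ (2 * (S * r + S / r * r ^+ 2))); last first.
    have -> : 2 * (S * r + S / r * r ^+ 2) = e * (S / (S + 1)).
      rewrite (_ : S / r * r ^+ 2 = S * r); last by field; rewrite gt_eqF.
      by rewrite /r; field; rewrite gt_eqF.
    by rewrite ler_piMr ?(ltW e0)// ler_pdivrMr// mul1r lerDl.
  apply: HK => [||t]; [by rewrite mulr_ge0// ltW|by rewrite divr_ge0// ltW|].
  rewrite trigpoly_catE trigpoly_cst trigpoly_shift addrC.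
  have -> : - trigpoly h t0 + trigpoly h (t + t0) = trigpoly h (t0 + t) - trigpoly h t0.
    by rewrite addrC [t + t0]addrC.
  apply: le_trans (trigpoly_translate_le _ _ _) _.
  rewrite /S /J big_map !mulr_suml -big_split/=.
  rewrite big_seq [leRHS]big_seq; apply: ler_sum => p ph.
  set b := normc (expi (p.2 * t) - 1).
  have b0 : 0 <= b by exact: normc_ge0.
  (* the kernel controls squares of b: large b are absorbed by b ^ 2 / r *)
  have br : b <= r + b ^+ 2 / r.
    have [|rb] := leP b r; first by move=> /le_trans; apply; rewrite lerDl divr_ge0 ?sqr_ge0// ltW.
    by rewrite ler_wpDl ?(ltW r0)// ler_pdivlMr// expr2 ler_wpM2l// ltW.
  apply: (@le_trans _ _ (normc p.1 * (r + b ^+ 2 / r))).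
    by rewrite ler_wpM2l ?normc_ge0.
  rewrite mulrDr lerD2l mulrA mulrAC ler_wpM2l//; first by rewrite divr_ge0 ?normc_ge0// ltW.
  rewrite (big_rem p ph)/= lerDl; apply: sumr_ge0 => q _; exact: sqr_ge0.
rewrite trigmean_mul_sub// in h2.
set T := trigmean _ in h1 h2.
have -> : trigpoly h t0 = T - (T - trigpoly h t0) by ring.
exact: normcB_le.
Qed.

Lemma continuousCP f : continuous (f : R -> R[i]^o) <->
  forall t e, 0 < e -> \forall u \near t, normc (f t - f u) <= e.
Proof.
have E z : `|z : R[i]^o| = (normc z)%:C by [].
split=> [cf t e e0|h t].
  have e0' : 0 < e%:C :> R[i] by rewrite ltcR.
  have /cvgrPdist_le/(_ _ e0') := cf t.
  by apply: filterS => u; rewrite E lecR.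
apply/cvgrPdist_le => -[b d]; rewrite ltcE/= => /andP[/eqP -> b0].
by apply: filterS (h t b b0) => u; rewrite E lecR.
Qed.

Lemma continuous_measurableC f : continuous (f : R -> R[i]^o) -> measurableC f.
Proof.
move=> /continuousCP cf; split; apply: continuous_measurable_fun => t;
  apply/cvgrPdist_le => e e0; apply: filterS (cf t e e0) => u; apply: le_trans.
  by rewrite -cReN -cReD normr_Re_le.
by rewrite -cImN -cImD normr_Im_le.
Qed.

Lemma uniform_limit_continuous f :
  (forall e, 0 < e -> exists2 g, continuous (g : R -> R[i]^o) &
    forall t, normc (f t - g t) <= e) -> continuous (f : R -> R[i]^o).
Proof.
move=> hf; apply/continuousCP => t e e0; have e3 : 0 < e / 3 by rewrite divr_gt0.
have [g /continuousCP cg fg] := hf _ e3.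
apply: filterS (cg t _ e3) => u gu.
have -> : e = (e / 3 + e / 3) + e / 3 by field.
apply: (@normc_dist_le _ (g u)); last by rewrite normcBC.
exact: (@normc_dist_le _ (g t)).
Qed.

Lemma continuous_trigpoly s : continuous (trigpoly s : R -> R[i]^o).
Proof.
apply/continuousCP => t e e0; have [C C0 HC] := trigpoly_lip s.
near=> u; apply: le_trans (HC _ _) _.
apply: (@le_trans _ _ ((C + 1) * (e / (C + 1)))); last first.
  by rewrite mulrC divfK// gt_eqF// ltr_wpDl.
apply: ler_pM => //; first by rewrite lerDl.
near: u; apply: (@cvgr_dist_le _ _ _ (nbhs t) _ id t) => //.
by rewrite divr_gt0// ltr_wpDl.
Unshelve. all: by end_near. Qed.

Lemma bohr_ap_uniform_limit f :
  (forall e, 0 < e -> exists s, forall t, normc (f t - trigpoly s t) <= e) -> bohr_ap f.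
Proof.
move=> hf; split.
  apply: uniform_limit_continuous => e /hf[s fs].
  by exists (trigpoly s) => //; exact: continuous_trigpoly.
move=> e e0; have e3 : 0 < e / 3 by rewrite divr_gt0.
have [s fs] := hf _ e3.
pose S := \sum_(p <- s) normc p.1.
have S1 : 0 < S + 1 by rewrite ltr_wpDl// sumr_ge0// => p _; exact: normc_ge0.
have d0 : 0 < e / 3 / (S + 1) by rewrite divr_gt0.
have [L L0 HL] := common_almost_periods [seq p.2 | p <- s] d0.
exists L => // a; have [u ua uJ] := HL a; exists u => // t.
have -> : e = (e / 3 + e / 3) + e / 3 by field.
apply: (@normc_dist_le _ (trigpoly s t)); last by rewrite normcBC.
apply: (@normc_dist_le _ (trigpoly s (t + u))); first exact: fs.
apply: le_trans (trigpoly_translate_le _ _ _) _.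
apply: (@le_trans _ _ (S * (e / 3 / (S + 1)))).
  rewrite mulr_suml big_seq [leRHS]big_seq; apply: ler_sum => p ps.
  by rewrite ler_wpM2l ?normc_ge0// uJ// map_f.
rewrite mulrA [S * _]mulrC -mulrA ler_piMr ?(ltW e3)//.
by rewrite ler_pdivrMr// mul1r lerDl.
Qed.

Theorem compact_in_AP x : compact (closure (translates x)) -> in_AP x.
Proof.
move=> cx.
have e0 (n : nat) : 0 < (n.+1%:R^-1 : R) by rewrite invr_gt0.
pose q n := projT1 (cid (filter_approximation cx (e0 n))).
have qP n s k : (forall t, normc (trigpoly s t) <= complex.Re (trigpoly k t)) ->
    normc (trigmean (trigmul s (q n)) - pairing x s) <= n.+1%:R^-1 * complex.Re (trigmean k).
  exact: (projT2 (cid (filter_approximation cx (e0 n)))).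
have [f fq] : exists f, forall n t, normc (f t - trigpoly (q n) t) <= n.+1%:R^-1.
  apply: uniform_cauchy_lim => n m t.
  have -> : trigpoly (q n) t - trigpoly (q m) t =
      trigpoly (q n ++ trigscale (-1) (q m)) t.
    by rewrite trigpoly_catE trigpoly_scale mulN1r.
  apply: trigpoly_sup_dual => s k sk.
  rewrite (trigmean_ext (k := trigmul s (q n) ++ trigscale (-1) (trigmul s (q m)))); last first.
    by move=> u; rewrite trigpoly_mul !trigpoly_catE !trigpoly_scale !trigpoly_mul; ring.
  rewrite trigmean_cat trigmean_scale mulN1r mulrDl.
  by apply: (@normc_dist_le _ (pairing x s)); [exact: qP|rewrite normcBC; exact: qP].
have fap : forall e, 0 < e -> exists s, forall t, normc (f t - trigpoly s t) <= e.
  move=> e /invS_lt[n ne]; exists (q n) => t; exact: le_trans (fq n t) (ltW ne).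
have bf := bohr_ap_uniform_limit fap.
have Bf : B f.
  apply: besicovitch_fun_uniform; first by apply: continuous_measurableC; case: bf.
  by move=> e /fap[s fs]; exists (trigpoly s) => //; exact: besicovitch_fun_trigpoly.
exists f => //.
suff <- : bes_class Bf = x by exact: representatives_class.
apply: fourier_uniqueness => l; apply/eqP; rewrite -subr_eq0; apply/eqP.
apply: normc_small0 => e e0'.
have [n ne] := invS_lt (divr_gt0 e0' (ltr0n _ 3)).
pose s := [:: (1 : R[i], - l)].
have E u : fourier_coef u l = pairing u s by rewrite /pairing big_seq1 mul1r opprK.
have sk t : normc (trigpoly s t) <= complex.Re (trigpoly [:: (1, 0)] t).
  by rewrite trigpoly1 trigpoly_cst mul1r normc_expi.
have m1 : complex.Re (trigmean [:: (1 : R[i], 0 : R)]) = 1.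
  by rewrite /trigmean big_cons big_nil/= eqxx addr0.
rewrite !E; have -> : e = 2 * (e / 3) + e / 3 by field.
apply: (@normc_dist_le _ (trigmean (trigmul s (q n)))); last first.
  by apply: le_trans (qP n _ _ sk) _; rewrite m1 mulr1 ltW.
pose y := bes_class (besicovitch_fun_trigpoly (q n)).
have -> : trigmean (trigmul s (q n)) = pairing y s.
  apply: has_mean_unique (has_mean_pairing s (representatives_class _)).
  rewrite (_ : _ \* _ = trigpoly (trigmul s (q n))); first exact: has_mean_trigpoly.
  by apply/funext => t /=; rewrite trigpoly_mul mulrC.
have fy : bes_ball (bes_class Bf) (e / 3) y.
  exact: (sup_bes_ball (representatives_class Bf) (representatives_class _) (fq n)).
by apply: le_trans (pairing_dist fy sk) _; rewrite m1 mulr1.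
Qed.

End CompactToAP.

(** * From almost periodicity to compactness *)

Section APToCompact.
Context {R : realType}.
Notation B := (besicovitch_fun R).
Implicit Types (f g : R -> R[i]) (l e t a c : R) (m z : R[i]).
Implicit Types (x y : besicovitch R).

(** Heine's theorem on a compact interval [[0, L]] extends to the line, since
    almost periods bring every point back to that interval. *)
Lemma bohr_uniformly_continuous f e : bohr_ap f -> 0 < e ->
  exists2 d, 0 < d & forall t r, `|r| <= d -> normc (f (t + r) - f t) <= e.
Proof.
move=> [/continuousCP cf apf] e0; have e3 : 0 < e / 3 by rewrite divr_gt0.
have [L L0 HL] := apf _ e3.
have /compact_near_coveringP/(_ R (nbhs (0 : R))
  (fun r u => normc (f (u + r) - f u) <= e / 3)) : compact `[0, L] by exact: segment_compact.
case=> [u _|d /= d0 dP].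
  have e6 : 0 < e / 3 / 2 by rewrite divr_gt0.
  have [d /= d0 dP] := cf u _ e6.
  exists (ball u (d / 2), ball (0 : R) (d / 2)) => /=.
    by split; apply: nbhsx_ballx; rewrite divr_gt0.
  move=> [v r] [/= uv r0]; rewrite (splitr (e / 3)).
  apply: (@normc_dist_le _ (f u)).
    rewrite normcBC; apply: dP; move: uv r0; rewrite /ball /= sub0r normrN => uv r0.
    by rewrite (splitr d) opprD addrA (le_lt_trans (ler_normB _ _))// ltrD.
  apply: dP; move: uv; rewrite /ball /= => /lt_le_trans; apply.
  by rewrite ler_piMr ?(ltW d0)// invf_le1 ?ler1n.
exists (d / 2) => [|t r rd]; first by rewrite divr_gt0.
have [s] := HL (- t); rewrite /= in_itv/= => /andP[s1 s2] sP.
have tK : `[0, L]%classic (t + s).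
  by rewrite /= in_itv/= -lerBlDl sub0r s1/= -lerBrDl addrC.
have fr : normc (f (t + s + r) - f (t + s)) <= e / 3.
  apply: dP tK; rewrite /ball /= sub0r normrN (le_lt_trans rd)//.
  by rewrite ltr_pdivrMr// ltr_pMr// ltr1n.
have -> : e = (e / 3 + e / 3) + e / 3 by field.
apply: (@normc_dist_le _ (f (t + s))); last exact: sP.
apply: (@normc_dist_le _ (f (t + s + r))) => //.
by rewrite normcBC addrAC; exact: sP.
Qed.

(** Up to [e / 2], the translate by [a] is the translate by some [r a] in
    [[0, L]]; by compactness [r] converges along [G], and uniform continuity
    turns this into uniform convergence. *)
Lemma bohr_ultra_cauchy f e (G : set_system R) : UltraFilter G -> bohr_ap f -> 0 < e ->
  exists b, G [set a | forall t, normc (f (t + a) - f (t + b)) <= e].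
Proof.
move=> GU bf e0; have e2 : 0 < e / 2 by rewrite divr_gt0.
have [d d0 dP] := bohr_uniformly_continuous bf e2.
have [_ /(_ _ e2)[L L0 HL]] := bf.
have hr a : exists r, `[0, L]%classic r /\ forall t, normc (f (t + r) - f (t + a)) <= e / 2.
  have [s] := HL (- a); rewrite /= in_itv/= => /andP[s1 s2] sP.
  exists (a + s); split=> [|t]; last by rewrite addrA.
  by rewrite in_itv/= -lerBlDl sub0r s1/= -lerBrDl addrC.
pose r a := projT1 (cid (hr a)).
have [rK rP] : (forall a, `[0, L]%classic (r a)) /\
    forall a t, normc (f (t + r a) - f (t + a)) <= e / 2.
  by split=> a; have [] := projT2 (cid (hr a)).
have [b [_ Gb]] : `[0, L]%classic `&` cluster (r @ G) !=set0.
  apply: (segment_compact (a := 0) (b := L)).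
  by apply: (@filterS _ G _ setT) => [a _|]; [exact: rK|exact: filterT].
exists b; have [|nG] := in_ultra_setVsetC [set a | `|r a - b| <= d] GU.
  apply: filterS => a ad t; rewrite (splitr e).
  apply: (@normc_dist_le _ (f (t + r a))); first by rewrite normcBC.
  by rewrite (_ : t + r a = t + b + (r a - b)); [exact: dP|ring].
have [|u [[a /negP ad <-]]] := Gb (r @` [set a | ~ (`|r a - b| <= d)])
    (ball b d) _ (nbhsx_ballx _ _ d0).
  apply: (@filterS _ G _ _ _ _ nG) => a ad; by exists a.
by move: ad; rewrite -ltNge /ball/= distrC ltNge => /negP + /ltW.
Qed.

Lemma bohr_ultra_limit f (G : set_system R) : UltraFilter G -> bohr_ap f ->
  exists g, forall e, 0 < e -> G [set a | forall t, normc (f (t + a) - g t) <= e].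
Proof.
move=> GU bf.
have e0 (n : nat) : 0 < (n.+1%:R^-1 : R) by rewrite invr_gt0.
pose b n := projT1 (cid (bohr_ultra_cauchy GU bf (e0 n))).
have bP n : G [set a | forall t, normc (f (t + a) - f (t + b n)) <= n.+1%:R^-1].
  exact: (projT2 (cid (bohr_ultra_cauchy GU bf (e0 n)))).
have [g gP] : exists g, forall n t, normc (g t - f (t + b n)) <= n.+1%:R^-1.
  apply: (@uniform_cauchy_lim _ _ (fun n t => f (t + b n))) => n m t.
  have [a [an am]] := filter_ex (filterI (bP n) (bP m)).
  by apply: (@normc_dist_le _ (f (t + a))); [rewrite normcBC|].
exists g => e e0'; have [n ne] := invS_lt (divr_gt0 e0' (ltr0n _ 2)).
apply: filterS (bP n) => a an t; rewrite (splitr e).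
apply: (@normc_dist_le _ (f (t + b n))); first exact: le_trans (an t) (ltW ne).
by rewrite normcBC; exact: le_trans (gP n t) (ltW ne).
Qed.

Lemma translates_ultra_limit x (G : set_system R) : UltraFilter G -> in_AP x ->
  exists y, forall e, 0 < e -> G [set a | bes_ball y e (shift a x)].
Proof.
move=> GU [f xf bf]; have [g gP] := bohr_ultra_limit GU bf.
have Bf := representatives_besicovitch xf; have [cf _] := bf.
have ga e : 0 < e -> exists a, forall t, normc (g t - f (t + a)) <= e.
  by move=> /gP/filter_ex[a ag]; exists a => t; rewrite normcBC.
have cg : continuous (g : R -> R[i]^o).
  apply: uniform_limit_continuous => e /ga[a ag].
  exists (fun t => f (t + a)); last exact: ag.
  move/continuousCP : cf => cf; apply/continuousCP => t d d0.
  have ca : (u + a) @[u --> t] --> t + a.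
    by apply: cvgD; [exact: cvg_id|exact: cvg_cst].
  exact: (ca _ (cf (t + a) d d0)).
have Bg : B g.
  apply: besicovitch_fun_uniform; first exact: continuous_measurableC.
  move=> e /ga[a ag]; exists (fun t => f (t + a)); last exact: ag.
  exact: besicovitch_fun_translate.
exists (bes_class Bg) => e e0; have e2 : 0 < e / 2 by rewrite divr_gt0.
apply: filterS (gP _ e2) => a ag.
apply: bes_ball_sym.
apply: (sup_bes_ball (representatives_shift a xf) (representatives_class _) ag).
by rewrite ltr_pdivrMr// ltr_pMr// ltr1n.
Qed.

Lemma ultra_limit_closure x y (G : set_system R) : ProperFilter G ->
  (forall e, 0 < e -> G [set a | bes_ball y e (shift a x)]) ->
  closure (translates x) y.
Proof.
move=> GF Gy; apply/closure_ballP => e /Gy/filter_ex[a ya].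
by exists (shift a x) => //; rewrite translatesE; exists a.
Qed.

(** A filter on the closure is followed, up to any precision, by a filter of
    translation parameters; the latter converges along an ultrafilter. *)
Theorem in_AP_compact x : in_AP x -> compact (closure (translates x)).
Proof.
move=> apx F FF Fx.
pose D := [set p : set (besicovitch R) * R | F p.1 /\ 0 < p.2].
pose T (p : set (besicovitch R) * R) :=
  [set a | exists2 y, p.1 y & bes_ball y p.2 (shift a x)].
have TF : ProperFilter (filter_from D T).
  apply: filter_from_proper; last first.
    move=> [V e] /= [FV e0]; have [y [Vy /closure_ballP/(_ _ e0)[z]]] := filter_ex (filterI FV Fx).
    by rewrite translatesE => -[a _ <-] ya; exists a, y.
  apply: filter_from_filter; first by exists (setT, 1); split=> //=; exact: filterT.
  move=> [V1 e1] [V2 e2] [/= FV1 e10] [/= FV2 e20].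
  exists (V1 `&` V2, Num.min e1 e2); first by split=> /=; [exact: filterI|rewrite lt_min e10].
  move=> a [y [V1y V2y] ya]; split; exists y => //=.
    by apply: bes_ball_mono ya; rewrite ge_min lexx.
  by apply: bes_ball_mono ya; rewrite ge_min lexx orbT.
have [G [GU TG]] := ultraFilterLemma TF.
have [y Gy] := translates_ultra_limit GU apx.
exists y; split; first exact: ultra_limit_closure Gy.
move=> V U FV /nbhs_ballP[e e0 eU]; have e2 : 0 < e / 2 by rewrite divr_gt0.
have GV : G (T (V, e / 2)) by apply: TG; exists (V, e / 2).
have [a [ya [z Vz za]]] := filter_ex (filterI (Gy _ e2) GV).
exists z; split=> //; apply: eU.
by rewrite (splitr e); exact: bes_ball_triangle ya (bes_ball_sym za).
Qed.

Lemma closure_fourier_coef x y l : closure (translates x) y ->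
  forall e, 0 < e -> exists2 a, bes_ball y e (shift a x) &
    normc (fourier_coef y l - expi (l * a) * fourier_coef x l) <= 2 * e.
Proof.
move=> /closure_ballP xy e /xy[z]; rewrite translatesE => -[a _ <-] ya.
by exists a => //; rewrite -fourier_coef_shift; exact: fourier_coef_dist.
Qed.

Lemma closure_exponents x y : closure (translates x) y -> exponents y `<=` exponents x.
Proof.
move=> xy l; apply: contra_neq => x0; apply: normc_small0 => e e0.
have e2 : 0 < e / 2 by rewrite divr_gt0.
have [a _] := closure_fourier_coef l xy e2.
by rewrite x0 mulr0 subr0 mulrC divfK.
Qed.

End APToCompact.

(** * Limits of exponentials and rational linear maps *)

Section IntegerBasis.
Context {R : realType}.
Implicit Types (L : seq R) (q : nat -> rat).

Definition rat_comb L q : R := \sum_(k < size L) ratr (q k) * L`_k.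

Definition rat_free L := forall q, rat_comb L q = 0 -> forall k, (k < size L)%N -> q k = 0.

Lemma rat_comb_ext L q r : (forall k, (k < size L)%N -> q k = r k) ->
  rat_comb L q = rat_comb L r.
Proof. by move=> qr; apply: eq_bigr => k _; rewrite qr. Qed.

Lemma common_denominator q n : exists2 D : int, D != 0 &
  forall k, (k < n)%N -> exists c : int, D%:~R * q k = c%:~R.
Proof.
elim: n => [|n [D D0 DP]]; first by exists 1.
exists (D * denq (q n)) => [|k]; first by rewrite mulf_neq0// denq_neq0.
rewrite ltnS leq_eqVlt => /orP[/eqP ->|/DP[c ck]].
  exists (D * numq (q n)); rewrite !rmorphM/= -mulrA numqE mulrC [in RHS]mulrC.
  by congr (_ * _); rewrite mulrC.
by exists (c * denq (q n)); rewrite !rmorphM/= mulrAC ck.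
Qed.

(** When a new element is already in the rational span, dividing the basis by
    a common denominator makes all its coordinates integers. *)
Lemma integer_basis L : exists2 M, rat_free M &
  forall l, l \in L -> exists c : nat -> int, l = rat_comb M (fun k => (c k)%:~R).
Proof.
elim: L => [|l L [M Mfree ML]]; first by exists [::].
have [[q lq]|lM] := pselect (exists q, l = rat_comb M q).
  have [D D0 Dq] := common_denominator q (size M).
  have D0' : (D%:~R : R) != 0 by rewrite intr_eq0.
  pose N := [seq a / D%:~R | a <- M].
  have NM r : rat_comb N r = rat_comb M r / D%:~R.
    rewrite /rat_comb size_map mulr_suml; apply: eq_bigr => k _.
    by rewrite (nth_map 0)// mulrA.
  have MN r : rat_comb M r = rat_comb N (fun k => D%:~R * r k).
    rewrite NM /rat_comb mulr_suml; apply: eq_bigr => k _.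
    by rewrite rmorphM/= ratr_int -!mulrA [RHS]mulrC -!mulrA mulVf// mulr1.
  exists N => [r|l'].
    rewrite NM size_map => /eqP; rewrite mulf_eq0 invr_eq0 (negPf D0') orbF => /eqP.
    exact: Mfree.
  rewrite inE => /orP[/eqP ->|/ML[c ->]].
    have hc k : exists c : int, (k < size M)%N -> D%:~R * q k = c%:~R.
      by have [/Dq[c ck]|_] := boolP (k < size M)%N; [exists c|exists 0].
    have [c cP] : exists c : nat -> int, forall k, (k < size M)%N -> D%:~R * q k = (c k)%:~R.
      by exists (fun k => projT1 (cid (hc k))) => k; exact: (projT2 (cid (hc k))).
    by exists c; rewrite lq MN; apply: rat_comb_ext => k; rewrite size_map; exact: cP.
  exists (fun k => D * c k); rewrite MN /rat_comb; apply: eq_bigr => k _.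
  by rewrite !rmorphM.
exists (rcons M l) => [q|l'].
  have E : rat_comb (rcons M l) q = rat_comb M q + ratr (q (size M)) * l.
    rewrite /rat_comb size_rcons big_ord_recr/= nth_rcons ltnn eqxx; congr (_ + _).
    by apply: eq_bigr => k _; rewrite nth_rcons ltn_ord.
  rewrite E => q0.
  have ql : q (size M) = 0.
    apply: contrapT => /eqP ql; apply: lM; exists (fun k => - q k / q (size M)).
    have ql' : ratr (q (size M)) != 0 :> R by rewrite fmorph_eq0.
    rewrite (_ : rat_comb _ _ = - rat_comb M q / ratr (q (size M))).
      by move/eqP : q0; rewrite addr_eq0 => /eqP ->; rewrite opprK mulrAC mulfV// mul1r.
    rewrite /rat_comb -sumrN mulr_suml; apply: eq_bigr => k _.
    by rewrite rmorphM fmorphV rmorphN/= mulNr mulNr mulrAC mulNr.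
  move: q0; rewrite ql rmorph0 mul0r addr0 => /Mfree q0 k.
  by rewrite size_rcons ltnS leq_eqVlt => /orP[/eqP ->//|]; exact: q0.
rewrite inE => /orP[/eqP ->|/ML[c ->]].
  exists (fun k => if (k < size M)%N then 0 else 1).
  rewrite /rat_comb size_rcons big_ord_recr/= nth_rcons ltnn eqxx rmorph1 mul1r.
  rewrite big1 ?add0r// => k _; by rewrite ltn_ord rmorph0 mul0r.
exists (fun k => if (k < size M)%N then c k else 0).
rewrite /rat_comb size_rcons big_ord_recr/= ltnn rmorph0 mul0r addr0.
by apply: eq_bigr => k _; rewrite nth_rcons !ltn_ord.
Qed.

Lemma rat_combD L q r a : rat_comb L (fun k => a * q k + r k) =
  ratr a * rat_comb L q + rat_comb L r.
Proof.
rewrite /rat_comb mulr_sumr -big_split/=; apply: eq_bigr => k _.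
by rewrite rmorphD rmorphM/= mulrDl mulrA.
Qed.

End IntegerBasis.

Section Characters.
Context {R : realType}.
Implicit Types (u v e th : R).

Lemma expi_2pi_int (k : int) : expi ((2 * pi) * k%:~R) = 1 :> R[i].
Proof.
have h (n : nat) : expi ((2 * pi) * n%:R) = 1 :> R[i].
  elim: n => [|n ih]; first by rewrite mulr0 expi0.
  rewrite -[n.+1%:R]natr1 mulrDr expiD ih mul1r mulr1 mulr_natl.
  by rewrite /expi cos2pi sin2pi.
case: k => n; first exact: h.
by rewrite NegzE rmorphN mulrN expiN h; apply: complexP; rewrite /= ?oppr0.
Qed.

Variable (G : set_system R).
Context {GU : UltraFilter G}.

Definition phase v th := forall e, 0 < e ->
  G [set a | normc (expi (v * a) - expi th) <= e].

Lemma phase_exists v : exists th, phase v th.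
Proof.
have p0 : 0 < 2 * pi :> R by rewrite mulr_gt0// pi_gt0.
pose r a : R := v * a - (2 * pi) * (Num.floor (v * a / (2 * pi)))%:~R.
have rE a : expi (r a) = expi (v * a) :> R[i].
  by rewrite /r -mulrN -rmorphN expiD expi_2pi_int mulr1.
have [th [_ Gth]] : `[0, 2 * pi]%classic `&` cluster (r @ G) !=set0.
  apply: (segment_compact (a := 0) (b := 2 * pi)).
  apply: (@filterS _ G _ setT) => [a _|]; last exact: filterT.
  rewrite /= in_itv/=; have /andP[h1 h2] := Num.Theory.floor_itv (v * a / (2 * pi)).
  rewrite ler_pdivlMr// in h1; rewrite ltr_pdivrMr// in h2.
  rewrite /r subr_ge0 mulrC h1/= lerBlDr; apply: le_trans (ltW h2) _.
  by rewrite rmorphD/= mulrDl mul1r addrC mulrC.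
exists th => e e0; have e2 : 0 < e / 2 by rewrite divr_gt0.
have [|nG] := in_ultra_setVsetC [set a | `|r a - th| <= e / 2] GU.
  apply: filterS => a ae; rewrite /mkset -rE; apply: le_trans (expi_lip _ _) _.
  by rewrite mulrC -ler_pdivlMr.
have [|u [[a /negP ae <-]]] := Gth (r @` [set a | ~ (`|r a - th| <= e / 2)])
    (ball th (e / 2)) _ (nbhsx_ballx _ _ e2).
  apply: (@filterS _ G _ _ _ _ nG) => a ae; by exists a.
by move: ae; rewrite -ltNge /ball/= distrC ltNge => /negP + /ltW.
Qed.

Lemma phaseD u v th th' : phase u th -> phase v th' -> phase (u + v) (th + th').
Proof.
move=> hu hv e e0; have e2 : 0 < e / 2 by rewrite divr_gt0.
apply: filterS2 (hu _ e2) (hv _ e2) => a ua va.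
rewrite /mkset mulrDl !expiD (splitr e).
apply: (@normc_dist_le _ (expi th * expi (v * a))).
  by rewrite -mulrBl normcM normc_expi mulr1.
by rewrite -mulrBr normcM normc_expi mul1r.
Qed.

Lemma phase0 : phase 0 0.
Proof.
move=> e e0; apply: (@filterS _ G _ setT) => [a _|]; last exact: filterT.
by rewrite /mkset mul0r subrr normc0 ltW.
Qed.

Lemma phaseN v th : phase v th -> phase (- v) (- th).
Proof.
move=> hv e e0; apply: filterS (hv e e0) => a; rewrite /mkset mulNr !expiN.
by rewrite (_ : conjc _ - _ = conjc (expi (v * a) - expi th)) ?normc_conj//; exact/esym/rmorphB.
Qed.

Lemma phase_int v th (c : int) : phase v th -> phase (c%:~R * v) (c%:~R * th).
Proof.
have h (n : nat) : phase v th -> phase (n%:R * v) (n%:R * th).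
  move=> hv; elim: n => [|n ih]; first by rewrite !mul0r; exact: phase0.
  by rewrite -[n.+1%:R]natr1 !mulrDl !mul1r; exact: phaseD.
by case: c => n hv; [exact: h|rewrite NegzE rmorphN !mulNr; apply: phaseN; exact: h].
Qed.

(** The limit character of the real line along [G] is lifted to a rational
    linear map on the span of [L] by lifting its values on a basis in which
    [L] has integer coordinates. *)
Lemma lift_phase (L : seq R) (V : set R) :
  (forall v, V v -> exists q : nat -> rat, v = rat_comb L q) ->
  exists2 psi : R -> R, qlinear_on V psi & forall l, l \in L -> phase l (psi l).
Proof.
move=> VL; have [M Mfree ML] := integer_basis L.
pose th k := projT1 (cid (phase_exists (nth 0 M k))).
have thP k : phase (nth 0 M k) (th k) := projT2 (cid (phase_exists (nth 0 M k))).
pose S q := \sum_(k < size M) ratr (q k) * th k.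
pose psi v := if pselect (exists q, v = rat_comb M q) is left H
  then S (projT1 (cid H)) else 0.
have psiE q : psi (rat_comb M q) = S q.
  rewrite /psi; case: pselect => [H|]; last by case; exists q.
  have := projT2 (cid H); set r := projT1 _ => qr.
  have : rat_comb M (fun k => - 1 * r k + q k) = 0.
    by rewrite rat_combD qr rmorphN rmorph1 mulN1r addrC subrr.
  move=> /Mfree h; apply: eq_bigr => k _; have /eqP := h k (ltn_ord k).
  by rewrite mulN1r addrC subr_eq0 => /eqP ->.
have LM l : l \in L -> exists q, l = rat_comb M q.
  by move=> /ML[c ->]; exists (fun k => (c k)%:~R).
have VM v : V v -> exists q, v = rat_comb M q.
  move=> /VL[q ->].
  have hL k : exists r : nat -> rat, (k < size L)%N -> L`_k = rat_comb M r.
    have [kL|_] := boolP (k < size L)%N; last by exists (fun=> 0).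
    by have [r rE] := LM _ (mem_nth 0 kL); exists r.
  pose r k := projT1 (cid (hL k)).
  have rP k : (k < size L)%N -> L`_k = rat_comb M (r k) := projT2 (cid (hL k)).
  exists (fun j => \sum_(k < size L) q k * r k j).
  rewrite {1}/rat_comb; transitivity (\sum_(k < size L) ratr (q k) * rat_comb M (r k)).
    by apply: eq_bigr => k _; rewrite -rP.
  rewrite /rat_comb; under eq_bigr do rewrite mulr_sumr.
  rewrite exchange_big; apply: eq_bigr => j _.
  rewrite rmorph_sum mulr_suml; apply: eq_bigr => k _.
  by rewrite rmorphM/= mulrA.
exists psi => [q u v /VM[qu ->] /VM[qv ->]|l /ML[c ->]].
  rewrite -rat_combD !psiE /S mulr_sumr -big_split/=; apply: eq_bigr => k _.
  by rewrite rmorphD rmorphM/= mulrDl mulrA.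
rewrite psiE /S /rat_comb.
elim/big_ind2 : _ => [|u1 t1 u2 t2 h1 h2|k _]; [exact: phase0|exact: phaseD|].
by rewrite ratr_int; exact: phase_int.
Qed.

End Characters.

Section Equivalence.
Context {R : realType}.
Implicit Types (x y : besicovitch R) (Lam : set R) (lam : nat -> R).

Lemma qspan0 lam n : qspan lam n 0.
Proof. by exists (fun=> 0); rewrite big1// => j _; rewrite rmorph0 mul0r. Qed.

Lemma qspanD lam n u v : qspan lam n u -> qspan lam n v -> qspan lam n (u + v).
Proof.
move=> [q ->] [r ->]; exists (fun j => q j + r j); rewrite -big_split/=.
by apply: eq_bigr => j _; rewrite rmorphD mulrDl.
Qed.

Lemma qspan_mem lam n j : (j < n)%N -> qspan lam n (lam j).
Proof.
move=> jn; exists (fun i => (i == Ordinal jn)%:R).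
rewrite (bigD1 (Ordinal jn))//= eqxx rmorph1 mul1r big1 ?addr0// => i /negPf ->.
by rewrite rmorph0 mul0r.
Qed.

Lemma qlinear_additive lam n psi : qlinear_on (qspan lam n) psi ->
  forall u v, qspan lam n u -> qspan lam n v -> psi (u + v) = psi u + psi v.
Proof. by move=> h u v hu hv; have := h 1 u v hu hv; rewrite rmorph1 !mul1r. Qed.

(** Along an ultrafilter following [y], the Fourier coefficients of the
    translates are multiplied by phases whose limit is lifted by [lift_phase]. *)
Lemma closure_sub_class Lam lam x : exponents x `<=` Lam ->
  closure (translates x) `<=` ap_class Lam lam x.
Proof.
move=> xLam y xy.
split; [exact: xLam|exact: subset_trans (closure_exponents xy) xLam|move=> n _ _].
pose D := [set e : R | 0 < e]; pose A e := [set a | bes_ball y e (shift a x)].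
have AF : ProperFilter (filter_from D A).
  apply: filter_from_proper; last first.
    by move=> e e0; have [a ya _] := closure_fourier_coef 0 xy e0; exists a.
  apply: filter_from_filter; first by exists 1; exact: ltr01.
  move=> e1 e2 /= e10 e20; exists (Num.min e1 e2); first by rewrite /D/= lt_min e10.
  by move=> a ya; split; apply: bes_ball_mono ya; rewrite ge_min lexx ?orbT.
have [G [GU AG]] := ultraFilterLemma AF.
pose L := [seq lam j | j <- iota 0 n].
have VL v : qspan lam n v -> exists q : nat -> rat, v = rat_comb L q.
  move=> [q ->]; exists (fun k => if insub k is Some j then q j else 0).
  rewrite /rat_comb size_map size_iota; apply: eq_bigr => j _.
  by rewrite valK (nth_map 0%N) ?size_iota// nth_iota.
have [psi psil psiP] := @lift_phase _ G GU L _ VL.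
exists psi => // j jn.
have jL : lam j \in L by apply/map_f; rewrite mem_iota.
apply/eqP; rewrite -subr_eq0; apply/eqP; apply: normc_small0 => e e0.
set c := fourier_coef x (lam j).
pose M := normc c + 2; have M0 : 0 < M by rewrite ltr_wpDl ?normc_ge0.
have eM : 0 < e / M by rewrite divr_gt0.
have GA : G (A (e / M)) by apply: AG; exists (e / M).
have [a [ya pa]] := filter_ex (filterI GA (psiP _ jL _ eM)).
have -> : e = 2 * (e / M) + normc c * (e / M) by rewrite /M; field; rewrite gt_eqF.
apply: (@normc_dist_le _ (fourier_coef (shift a x) (lam j))).
  exact: fourier_coef_dist.
rewrite fourier_coef_shift -/c mulrC -mulrBr normcM ler_wpM2l ?normc_ge0//.
Qed.

(** Kronecker's theorem at the indices below [n]. As those beyond the cardinal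
    of [Lam] carry no condition, the approximations are nested in [n] even when
    [Lam] is finite, and generate a filter. *)
Lemma class_approximation Lam lam x y n d : ap_class Lam lam x y -> 0 < d ->
  exists a, forall j, (j < n)%N -> (`I_j.+1 #<= Lam)%card ->
    normc (fourier_coef y (lam j) - expi (lam j * a) * fourier_coef x (lam j)) <= d.
Proof.
move=> [_ _ xy] d0; elim: n => [|n [a ih]]; first by exists 0.
have [nL|nL] := pselect (`I_n.+1 #<= Lam)%card; last first.
  exists a => j; rewrite ltnS leq_eqVlt => /orP[/eqP -> //|]; exact: ih.
have [psi psil psiP] := xy n.+1 isT nL.
pose M := \sum_(j < n.+1) normc (fourier_coef x (lam j)) + 1.
have M0 : 0 < M by rewrite ltr_wpDl// sumr_ge0// => j _; exact: normc_ge0.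
have dM : 0 < d / M by rewrite divr_gt0.
have [|L L0 HL] := @kronecker R (qspan lam n.+1) psi [seq lam j | j <- iota 0 n.+1] _
    (qspan0 _ _) (@qspanD _ _) (qlinear_additive psil) _ dM.
  by move=> _ /mapP[j + ->]; rewrite mem_iota => /andP[_ jn]; exact: qspan_mem.
have [b _ bP] := HL 0; exists b => j jn _; rewrite psiP// mulrC -mulrBl normcM normcBC.
apply: (@le_trans _ _ (d / M * M)); last by rewrite divfK// gt_eqF.
apply: ler_pM; rewrite ?normc_ge0//; first by apply: bP; apply/map_f; rewrite mem_iota.
by rewrite /M (bigD1 (Ordinal jn))//= -addrA lerDl addr_ge0// sumr_ge0// => i _; exact: normc_ge0.
Qed.

(** Along an ultrafilter refining the approximations of all the phases, the
    translates converge to some [z], whose coefficients are those of [y]. *)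
Lemma class_sub_closure Lam lam x : enumeration Lam lam -> in_AP x ->
  ap_class Lam lam x `<=` closure (translates x).
Proof.
move=> [_ _ lamS] apx y xy.
pose D := [set p : nat * R | 0 < p.2].
pose A (p : nat * R) := [set a | forall j, (j < p.1)%N -> (`I_j.+1 #<= Lam)%card ->
    normc (fourier_coef y (lam j) - expi (lam j * a) * fourier_coef x (lam j)) <= p.2].
have AF : ProperFilter (filter_from D A).
  apply: filter_from_proper; last first.
    by move=> [n d] /= d0; have [a aP] := class_approximation n xy d0; exists a.
  apply: filter_from_filter; first by exists (0%N, 1); exact: ltr01.
  move=> [n1 d1] [n2 d2] /= d10 d20; exists (maxn n1 n2, Num.min d1 d2).
    by rewrite /D/= lt_min d10.
  by move=> a aP; split=> j jn jL; apply: le_trans (aP j _ jL) _;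
    rewrite /= ?ge_min ?lexx ?orbT// (leq_trans jn)// ?leq_maxl ?leq_maxr.
have [G [GU AG]] := ultraFilterLemma AF.
have [z Gz] := translates_ultra_limit GU apx.
have xz : closure (translates x) z by exact: ultra_limit_closure Gz.
suff <- : z = y by [].
have [xLam yLam _] := xy.
apply: fourier_uniqueness => l; have [lL|lL] := pselect (Lam l); last first.
  have zero w : exponents w `<=` Lam -> fourier_coef w l = 0.
    by move=> wL; apply: contrapT => /eqP wl; apply: lL; exact: wL.
  by rewrite (zero y yLam) (zero z (subset_trans (closure_exponents xz) xLam)).
have [j jL <-] := lamS _ lL.
apply/eqP; rewrite -subr_eq0; apply/eqP; apply: normc_small0 => e e0.
have e3 : 0 < e / 3 by rewrite divr_gt0.
have GA : G (A (j.+1, e / 3)) by apply: AG; exists (j.+1, e / 3).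
have [a [za /(_ j (ltnSn j) jL) ya]] := filter_ex (filterI (Gz _ e3) GA).
have -> : e = 2 * (e / 3) + e / 3 by field.
apply: (@normc_dist_le _ (fourier_coef (shift a x) (lam j))).
  exact: fourier_coef_dist.
by rewrite fourier_coef_shift normcBC.
Qed.

End Equivalence.

Theorem theorem3 (R : realType) (f : besicovitch R)
    (Lam : set R) (lam : nat -> R) :
  enumeration Lam lam -> (exponents f `<=` Lam)%classic ->
  in_AP f <->
  compact (closure (translates f)) /\
  closure (translates f) = ap_class Lam lam f.
Proof.
move=> enum fLam; split=> [apf|[cf _]]; last exact: compact_in_AP.
split; first exact: in_AP_compact.
apply/seteqP; split; first exact: closure_sub_class.
exact: class_sub_closure.
Qed.
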